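(* $\mathsf{EMVol}$ is distinct from $\mathsf{DMVol}$ on trees and on general graphs: in each of these two graph classes there is an LCL problem with expected mending volume $\mathsf{EMVol}=o(n)$ but deterministic mending volume $\mathsf{DMVol}=\Theta(n)$.
   Context: All graphs have maximum degree bounded by a constant. An LCL problem $\Pi=(\Sigma,\mathcal G,\phi)$ consists of a finite label set $\Sigma$, a class $\mathcal G$ of input graphs, and a local verifier $\phi$ of constant radius $r$: $\phi(G,\lambda,v)\in\{\text{happy},\text{unhappy}\}$ depends only on the isomorphism type of the labeled radius-$r$ neighborhood of $v$. A partial solution is a labeling $\lambda:V(G)\to\Sigma\sqcup\{\bot\}$ such that every vertex with no $\bot$ within distance $r$ is happy. A hole is a vertex labeled $\bot$. A mend of $\lambda$ at a hole $v$ is a partial solution $\lambda'$ with $\lambda'(v)\neq\bot$ and $\lambda'(u)\neq\bot$ whenever $\lambda(u)\ne\bot$. Mends are assumed to always exist. A set $W\subseteq V(G)$ contains a mend of $\lambda$ at $v$ if some mend $\lambda'$ of $\lambda$ at $v$ satisfies $\{u:\lambda'(u)\ne\lambda(u)\}\subseteq W$. A (local) mender $\mathcal M$ assigns to each $(G,\lambda,v)$ a Markov chain $\mathcal M_{G,\lambda,v}$ on subsets of $V(G)$ such that: (progress) $\mathcal M_{G,\lambda,v}(W,W')>0$ implies $W\subseteq W'$; (termination) $\mathcal M_{G,\lambda,v}(W,W)=1$ iff $W$ contains a mend of $\lambda$ at $v$; (locality) $\mathcal M_{G,\lambda,v}(W,\cdot)$ depends only on $W$ and its direct neighborhood. In the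 exploration model only neighbors of already explored vertices can be newly explored, so states reached from $\{v\}$ are connected. The chain is absorbing; $\mathcal M^*_{G,\lambda,v}(\{v\},\cdot)$ is its limiting distribution started at $\{v\}$, and $\mathcal F=\mathcal F^{\mathcal M}_{G,\lambda,v}(\{v\})$ is the set of absorbing (final) states reachable from $\{v\}$. Then $\mathsf{EMVol}(\mathcal M,G)=\max_{\lambda,v}\sum_{W_F}\mathcal M^*_{G,\lambda,v}(\{v\},W_F)|W_F|$ and $\mathsf{DMVol}(\mathcal M,G)=\max_{\lambda,v}\max_{W_F\in\mathcal F}|W_F|$. For each such measure $X$: $\Pi$ has $X=O(T)$ (resp. $o(T)$) if there is a mender $\mathcal M$ with $X(\mathcal M,G_n)=O(T(n))$ (resp. $o(T(n))$) on all instances $G_n\in\mathcal G$ of size $n$; $\Pi$ has $X=\Omega(T)$ if for every mender $\mathcal M$ there are instances $G_n$ of size $n$ with $X(\mathcal M,G_n)=\Omega(T(n))$; $\Theta$ means both $O$ and $\Omega$.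
   Formalization: Locality of a mender is required only between states that contain no mend: whether W contains a mend depends on vertices beyond its direct neighborhood, so unconditional locality would clash with the termination condition. *)

(* Defs.v *)
From HB Require Import structures.
From mathcomp Require Export all_boot all_order all_algebra.
From mathcomp Require Export finmap.
From mathcomp Require Export all_classical all_reals all_analysis.

Set Implicit Arguments.
Unset Strict Implicit.
Unset Printing Implicit Defensive.

Import Order.TTheory GRing.Theory Num.Theory.
Import numFieldNormedType.Exports.

Local Open Scope ring_scope.

(** * Graphs *)

(* Finite simple graphs.  The vertices are natural numbers, so that "the same
   set of vertices" makes sense in two different graphs; this is what the
   locality of a mender refers to. *)
Record graph := Graph {
  vset : {fset nat};
  adj : rel nat;
  adj_sym : symmetric adj;
  adj_irr : irreflexive adj;
  adj_vset : forall x y, adj x y -> x \in vset }.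

Definition vertex (G : graph) : finType := vset G.

Definition gadj (G : graph) : rel (vertex G) :=
  fun x y => adj G (fsval x) (fsval y).

Definition gsize (G : graph) : nat := #|` vset G|.

Definition degree_le (D : nat) (G : graph) : Prop :=
  forall x : vertex G, (#|[set y | gadj x y]| <= D)%N.

Definition tree (G : graph) : Prop :=
  [/\ (0 < gsize G)%N,
      forall x y : vertex G, connect (@gadj G) x y
    & forall s : seq (vertex G), (2 < size s)%N -> ~ ucycle (@gadj G) s].

(* W together with its direct neighborhood. *)
Definition cnbhd (G : graph) (W : {set vertex G}) : {set vertex G} :=
  W :|: [set y | [exists x in W, gadj x y]].

(* The vertices at distance at most r from v. *)
Definition ball (G : graph) (r : nat) (v : vertex G) : {set vertex G} :=
  iter r (@cnbhd G) [set v].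

Definition names (G : graph) (W : {set vertex G}) : {fset nat} :=
  [fset fsval x | x in W]%fset.

(** * Locally checkable labelings *)

(* [None] is the label of a hole. *)
Definition labeling (S : finType) (G : graph) := {ffun vertex G -> option S}.

(* The labeled radius-r neighborhoods of v in G and of v' in G' are isomorphic
   as rooted labeled graphs. *)
Definition ball_iso (S : finType) (r : nat)
    (G : graph) (l : labeling S G) (v : vertex G)
    (G' : graph) (l' : labeling S G') (v' : vertex G') : Prop :=
  exists f : vertex G -> vertex G',
    [/\ f v = v',
        f @: ball r v = ball r v',
        {in ball r v &, injective f},
        {in ball r v &, forall x y, gadj (f x) (f y) = gadj x y}
      & {in ball r v, forall x, l' (f x) = l x}].

Record lcl := Lcl {
  lab : finType;
  gclass : graph -> Prop;
  gclass_deg : exists D, forall G, gclass G -> degree_le D G;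
  rad : nat;
  happy : forall G, labeling lab G -> vertex G -> bool;
  happy_local : forall G (l : labeling lab G) v G' (l' : labeling lab G') v',
    gclass G -> gclass G' -> ball_iso rad l v l' v' ->
    happy l v = happy l' v' }.

Definition partial_solution (P : lcl) (G : graph) (l : labeling (lab P) G) :=
  [forall v, [forall u in ball (rad P) v, l u != None] ==> happy l v].

Definition is_mend (P : lcl) (G : graph) (l : labeling (lab P) G)
    (v : vertex G) (l' : labeling (lab P) G) : bool :=
  [&& partial_solution l', l' v != None
    & [forall u, (l u != None) ==> (l' u != None)]].

Definition contains_mend (P : lcl) (G : graph) (l : labeling (lab P) G)
    (v : vertex G) (W : {set vertex G}) : bool :=
  [exists l', is_mend l v l' && ([set u | l' u != l u] \subset W)].

Definition hole_instance (P : lcl) (G : graph) (l : labeling (lab P) G)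
    (v : vertex G) : bool :=
  partial_solution l && (l v == None).

Definition mends_exist (P : lcl) : Prop :=
  forall G (l : labeling (lab P) G) v, gclass P G -> hole_instance l v ->
    exists l', is_mend l v l'.

(** * Menders *)

(* A family of transition kernels: [M G l v W W'] is the probability of moving
   from the state W to the state W'. *)
Definition kernels (R : realType) (P : lcl) :=
  forall G : graph, labeling (lab P) G -> vertex G ->
    {set vertex G} -> {set vertex G} -> R.

(* W in (G, l, v) and W' in (G', l', v') look the same: same explored vertices,
   same starting vertex, same neighboring vertices, and the same edges and
   labels on these. *)
Definition same_view (S : finType)
    (G : graph) (l : labeling S G) (v : vertex G) (W : {set vertex G})
    (G' : graph) (l' : labeling S G') (v' : vertex G') (W' : {set vertex G'})
    : Prop :=
  [/\ fsval v = fsval v',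
      names W = names W',
      names (cnbhd W) = names (cnbhd W'),
      {in names (cnbhd W) &, forall a b, adj G a b = adj G' a b}
    & forall x x', x \in cnbhd W -> fsval x = fsval x' -> l x = l' x'].

(* The conditions are imposed on the states that contain the starting vertex v,
   the only ones that the chain started at {v} can visit.  (A state without v
   never contains a mend; the empty one could not be left by exploring
   neighbors.)
   The termination condition prescribes M (W, .) entirely when W contains a
   mend, and whether it does depends, through the radius of the verifier, on
   more than the direct neighborhood of W.  Hence the locality condition
   compares two states neither of which contains a mend. *)
Record is_mender (R : realType) (P : lcl) (M : kernels R P) : Prop := IsMender {
  mender_ge0 : forall G (l : labeling (lab P) G) v (W W' : {set vertex G}),
    gclass P G -> hole_instance l v -> v \in W -> 0 <= M G l v W W';
  mender_sum1 : forall G (l : labeling (lab P) G) v (W : {set vertex G}),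
    gclass P G -> hole_instance l v -> v \in W -> \sum_W' M G l v W W' = 1;
  mender_progress : forall G (l : labeling (lab P) G) v (W W' : {set vertex G}),
    gclass P G -> hole_instance l v -> v \in W ->
    0 < M G l v W W' -> W \subset W';
  mender_exploration :
    forall G (l : labeling (lab P) G) v (W W' : {set vertex G}),
    gclass P G -> hole_instance l v -> v \in W ->
    0 < M G l v W W' -> W' \subset cnbhd W;
  mender_termination : forall G (l : labeling (lab P) G) v (W : {set vertex G}),
    gclass P G -> hole_instance l v -> v \in W ->
    M G l v W W = 1 <-> contains_mend l v W;
  mender_locality :
    forall G (l : labeling (lab P) G) v (W : {set vertex G})
           G' (l' : labeling (lab P) G') v' (W' : {set vertex G'}),
    gclass P G -> hole_instance l v -> v \in W ->
    gclass P G' -> hole_instance l' v' -> v' \in W' ->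
    ~~ contains_mend l v W -> ~~ contains_mend l' v' W' ->
    same_view l v W l' v' W' ->
    forall (U : {set vertex G}) (U' : {set vertex G'}),
      names U = names U' -> M G l v W U = M G' l' v' W' U' }.

Section Measures.
Variables (R : realType) (P : lcl) (M : kernels R P).

(* t-step transition probabilities *)
Fixpoint steps (G : graph) (l : labeling (lab P) G) (v : vertex G) (t : nat)
    (W W' : {set vertex G}) : R :=
  if t is t'.+1 then \sum_U M l v W U * steps l v t' U W' else (W == W')%:R.

Definition limit_dist (G : graph) (l : labeling (lab P) G) (v : vertex G)
    (W W' : {set vertex G}) : R :=
  lim ((fun t : nat => steps l v t W W') @ \oo)%classic.

(* The absorbing states reachable from {v}. *)
Definition final (G : graph) (l : labeling (lab P) G) (v : vertex G)
    : {set {set vertex G}} :=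
  [set W | (M l v W W == 1)
         & connect (fun A B : {set vertex G} => 0 < M l v A B) [set v] W].

Definition EMVol (G : graph) : R :=
  \big[Num.max/0]_(i : labeling (lab P) G * vertex G | hole_instance i.1 i.2)
    \sum_(W in final i.1 i.2) limit_dist i.1 i.2 [set i.2] W * #|W|%:R.

Definition DMVol (G : graph) : R :=
  (\max_(i : labeling (lab P) G * vertex G | hole_instance i.1 i.2)
    \max_(W in final i.1 i.2) #|W|)%:R.

End Measures.

(** * Asymptotics, for a volume measure X such as [EMVol] or [DMVol] *)

Definition volume (R : realType) := forall P : lcl, kernels R P -> graph -> R.

Definition has_O (R : realType) (P : lcl) (X : volume R) (T : nat -> R) :=
  exists M : kernels R P, is_mender M /\
    exists (C : R) (N : nat), 0 < C /\
      forall G, gclass P G -> (N <= gsize G)%N -> X P M G <= C * T (gsize G).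

Definition has_o (R : realType) (P : lcl) (X : volume R) (T : nat -> R) :=
  exists M : kernels R P, is_mender M /\
    forall e : R, 0 < e -> exists N : nat,
      forall G, gclass P G -> (N <= gsize G)%N -> X P M G <= e * T (gsize G).

Definition has_Omega (R : realType) (P : lcl) (X : volume R) (T : nat -> R) :=
  forall M : kernels R P, is_mender M ->
    exists (c : R) (N : nat), 0 < c /\
      forall n, (N <= n)%N ->
        exists G, [/\ gclass P G, gsize G = n & c * T n <= X P M G].

Definition has_Theta (R : realType) (P : lcl) (X : volume R) (T : nat -> R) :=
  has_O P X T /\ has_Omega P X T.

(* Main.v *)
(** The problem is a sinkless orientation of the vertices of degree at least 3
("clauses") in which the edges are vertices of degree at most 2.  A clause wants
a neighbor labeled [want]; as the wish depends on the degree (3 and 4 against 5),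
the label of an edge vertex between a clause of each kind says which of its two
ends owns it.  The label [None] ("joker") satisfies every clause, but is forbidden at
degree at most 2.

Mending: an unsatisfied clause takes over one of its edges.  The former owner is
then the only clause that can be unsatisfied, and only if it owned nothing else.
A random walk that always takes over a uniformly random edge thus moves down a
tree in which each clause has at least two children.  If [D] is the number of
descendants of the current vertex, then [E sqrt D] drops by a constant factor at
each clause, so the walk ends after O(sqrt n) expected steps.

Against a given mender, run it on an infinite tree in which every clause but the
root owns just the edge to its parent, the root being the hole.  A finite set of
full-degree clauses contains no mend, and by locality the run is also possible on
every finite subtree that contains a neighborhood of the explored set.  So
the run continues until it has explored a constant fraction of [n] vertices,
after which the tree is cut off at exactly [n] vertices. *)

Require Import Defs.
From mathcomp Require Import fintype finset zify ring lra.

Set Implicit Arguments.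
Unset Strict Implicit.
Unset Printing Implicit Defensive.

Import Order.TTheory GRing.Theory Num.Theory.
Import numFieldNormedType.Exports.

Local Open Scope nat_scope.

(** * The problem *)

Definition nbrs (G : graph) (x : vertex G) : {set vertex G} := [set y | gadj x y].

Definition deg (G : graph) (x : vertex G) : nat := #|nbrs x|.

Lemma gadjC (G : graph) : symmetric (@gadj G).
Proof. by move=> x y; rewrite /gadj adj_sym. Qed.

Lemma gadjxx (G : graph) (x : vertex G) : gadj x x = false.
Proof. by rewrite /gadj adj_irr. Qed.

Lemma in_nbrs (G : graph) (x y : vertex G) : (y \in nbrs x) = gadj x y.
Proof. by rewrite inE. Qed.

Lemma in_cnbhd (G : graph) (W : {set vertex G}) y :
  (y \in cnbhd W) = (y \in W) || [exists x in W, gadj x y].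
Proof. by rewrite !inE. Qed.

Lemma in_cnbhd1 (G : graph) (x y : vertex G) :
  (y \in cnbhd [set x]) = (y == x) || gadj x y.
Proof.
rewrite in_cnbhd inE; congr orb; apply/existsP/idP => [[z]|xy].
  by rewrite inE => /andP[/eqP ->].
by exists x; rewrite inE eqxx.
Qed.

Lemma deg2_nbrs (G : graph) (y u z : vertex G) :
  deg y <= 2 -> gadj y u -> gadj y z -> u != z -> nbrs y = [set u; z].
Proof.
move=> dy yu yz uz; apply/esym/eqP; rewrite eqEcard cards2 uz (leq_trans dy) // andbT.
by apply/subsetP => w; rewrite !inE => /orP[] /eqP ->.
Qed.

(** The outer option is the layer of holes; [Some None] is the joker. *)
Definition supports (b : bool) (o : option (option bool)) : bool :=
  (o == Some None) || (o == Some (Some b)).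

Definition want (G : graph) (x : vertex G) : bool := deg x < 5.

Notation olabeling := (labeling (option bool : finType)).

Definition supported (G : graph) (l : olabeling G) (x : vertex G) : bool :=
  [exists y, gadj x y && supports (want x) (l y)].

Definition happy_at (G : graph) (l : olabeling G) (x : vertex G) : bool :=
  if deg x <= 2 then l x != Some None else supported l x.

Lemma ball_iso1_nbrs (S : finType) G (l : labeling S G) v G' (l' : labeling S G') v' f :
  [/\ f v = v', f @: ball 1 v = ball 1 v', {in ball 1 v &, injective f},
      {in ball 1 v &, forall x y, gadj (f x) (f y) = gadj x y}
    & {in ball 1 v, forall x, l' (f x) = l x}] ->
  f @: nbrs v = nbrs v'.
Proof.
move=> [fv fb finj fadj _]; have vv : v \in ball 1 v by rewrite in_cnbhd1 eqxx.
have sub x : gadj v x -> x \in ball 1 v by move=> vx; rewrite in_cnbhd1 vx orbT.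
apply/setP => z; rewrite in_nbrs; apply/imsetP/idP => [[x]|vz].
  by rewrite in_nbrs => vx ->; rewrite -fv fadj // sub.
have : z \in f @: ball 1 v by rewrite fb in_cnbhd1 vz orbT.
by case/imsetP => x xb zE; exists x => //; rewrite in_nbrs -fadj // fv -zE.
Qed.

Lemma happy_at_local G (l : olabeling G) v G' (l' : olabeling G') v' :
  ball_iso 1 l v l' v' -> happy_at l v = happy_at l' v'.
Proof.
move=> [f H]; have fN := ball_iso1_nbrs H; case: H => fv _ finj _ fl.
have vv : v \in ball 1 v by rewrite in_cnbhd1 eqxx.
have sub x : gadj v x -> x \in ball 1 v by move=> vx; rewrite in_cnbhd1 vx orbT.
have dE : deg v' = deg v.
  rewrite /deg -fN card_in_imset // => x y; rewrite !in_nbrs => /sub xb /sub yb.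
  exact: finj.
rewrite /happy_at dE -fv fl // /supported /want fv dE; case: ifP => // _.
apply/existsP/existsP => -[y /andP[vy sy]].
  exists (f y); rewrite fl ?sub // sy andbT -in_nbrs -fN imset_f // in_nbrs //.
move: vy; rewrite -in_nbrs -fN => /imsetP[x]; rewrite in_nbrs => vx yE.
by exists x; rewrite vx -(fl _ (sub _ vx)) -yE.
Qed.

Definition sinkless (gc : graph -> Prop)
    (gcD : exists D, forall G, gc G -> degree_le D G) : lcl :=
  @Lcl (option bool) gc gcD 1 happy_at (fun G l v G' l' v' _ _ => @happy_at_local G l v G' l' v').

(** * Joker and takeover as local repairs *)

Section Fix_graph.
Variable (G : graph).
Implicit Types (l m : olabeling G) (x y z u v w q : vertex G) (W : {set vertex G}).

(** The guard in [partial_solution] for radius 1: no hole in sight of [x]. *)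
Definition labeled_around l x : bool := [forall y in cnbhd [set x], l y != None].

Lemma labeled_around_self l x : labeled_around l x -> l x != None.
Proof. by move/forall_inP; apply; rewrite in_cnbhd1 eqxx. Qed.

Lemma labeled_around_nbr l x y : labeled_around l x -> gadj x y -> l y != None.
Proof. by move=> /forall_inP H xy; apply: H; rewrite in_cnbhd1 xy orbT. Qed.

Lemma eq_labeled_around l m x :
  (forall y, (y == x) || gadj x y -> (l y == None) = (m y == None)) ->
  labeled_around l x = labeled_around m x.
Proof.
move=> H; apply: eq_forallb_in => y; rewrite in_cnbhd1 => /H.
by move=> ->.
Qed.

Definition upd m y (o : option (option bool)) : olabeling G :=
  [ffun x => if x == y then o else m x].

Lemma updE m y o x : upd m y o x = if x == y then o else m x.
Proof. by rewrite ffunE. Qed.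

Lemma labeled_around_upd m y o x : (o == None) = (m y == None) ->
  labeled_around (upd m y o) x = labeled_around m x.
Proof. by move=> H; apply: eq_labeled_around => z _; rewrite updE; case: (z =P y) => // ->. Qed.

Lemma supportedP l x : reflect (exists2 y, gadj x y & supports (want x) (l y)) (supported l x).
Proof.
apply: (iffP existsP) => -[y]; first by case/andP; exists y.
by move=> xy sy; exists y; rewrite xy.
Qed.

Lemma happy_at_big l x : 2 < deg x -> happy_at l x = supported l x.
Proof. by rewrite /happy_at ltnNge => /negbTE ->. Qed.

Definition almost m u : Prop := forall x, x != u -> labeled_around m x -> happy_at m x.

(** Two adjacent clauses end the walk: the happiness of a clause does not depend on its own label,
    so [y] can take the joker, which supports [u] and harms no neighbor. *)
Lemma almost_joker m u y : almost m u -> gadj u y -> 2 < deg y -> 2 < deg u ->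
  m y != None -> forall x, labeled_around (upd m y (Some None)) x -> happy_at (upd m y (Some None)) x.
Proof.
move=> Ha uy dy du my x; rewrite labeled_around_upd ?(negbTE my) // => fx.
case: (leqP (deg x) 2) => dx.
  have xu : x != u by apply: contraTneq dx => ->; rewrite -ltnNge.
  move: (Ha _ xu fx); rewrite /happy_at dx updE; case: (x =P y) dx => // ->.
  by rewrite leqNgt dy.
rewrite happy_at_big //; case: (eqVneq x u) => [->|xu].
  by apply/supportedP; exists y; rewrite // updE eqxx.
move: (Ha _ xu fx); rewrite happy_at_big // => /supportedP[q xq sq].
by apply/supportedP; exists q => //; rewrite updE; case: (q =P y).
Qed.

(** Only a clause that relied on the old label of [y] can lose by the takeover, so it is an end of
    [y], and no other neighbor supports it. *)
Lemma almost_flip m u y x : almost m u -> gadj u y -> deg y <= 2 -> 2 < deg u ->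
  m y != None -> labeled_around (upd m y (Some (Some (want u)))) x ->
  ~~ happy_at (upd m y (Some (Some (want u)))) x ->
  [/\ x != u, 2 < deg x, gadj y x, supports (want x) (m y)
    & forall q, gadj x q -> ~~ supports (want x) (upd m y (Some (Some (want u))) q)].
Proof.
move=> Ha uy dy du my; rewrite labeled_around_upd ?(negbTE my) // => fx.
case: (leqP (deg x) 2) => dx.
  have xu : x != u by apply: contraTneq dx => ->; rewrite -ltnNge.
  move: (Ha _ xu fx); rewrite /happy_at dx updE.
  by case: (x == y) => // ->.
rewrite happy_at_big // => nsx.
have nq q : gadj x q -> ~~ supports (want x) (upd m y (Some (Some (want u))) q).
  by move=> xq; apply: contra nsx => sq; apply/supportedP; exists q.
have xu : x != u.
  by apply: contra nsx => /eqP ->; apply/supportedP; exists y => //; rewrite updE eqxx /supports eqxx orbT.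
move: (Ha _ xu fx); rewrite happy_at_big // => /supportedP[q xq sq].
move: (nq _ xq); rewrite updE; case: (q =P y) => [qy _|_]; last by rewrite sq.
by subst q; split=> //; rewrite gadjC.
Qed.

End Fix_graph.

(** * Walking to a mend *)

Section Walk.
Variables (G : graph) (l : olabeling G) (v : vertex G).
Implicit Types (m : olabeling G) (x y z u w q : vertex G) (W : {set vertex G}).

(** [contains_mend] unfolded for radius 1; unlike the problem [sinkless] it does not depend on a
    graph class. *)
Definition mendable W : Prop :=
  exists m, [/\ forall x, labeled_around m x -> happy_at m x, m v != None,
    forall x, l x != None -> m x != None & forall x, m x != l x -> x \in W].

(* The vertices from which a walk can reach [y]; on a walk there is exactly one,
   which makes the possible walks a tree. *)
Definition parents y : {set vertex G} :=
  if deg y <= 2 then [set q | [&& gadj y q, 2 < deg q & ~~ supports (want q) (l y)]]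
  else [set q | gadj y q && supports (want y) (l q)].

(* [m] is [l] after the takeovers made along the walk, and [u] is the clause that
   has just lost its support.  The supporting [q] of [wi_sup] is kept away from
   unexplored vertices so that later takeovers do not change its label. *)
Record walk_inv W u m : Prop := WalkInv {
  wi_v : v \in W;
  wi_Nv : nbrs v \subset W;
  wi_chg : forall x, m x != l x -> x \in W;
  wi_none : forall x, (m x == None) = (l x == None) && (x != v);
  wi_alm : almost m u;
  wi_deg : 2 < deg u;
  wi_u : u \in W;
  wi_sup : forall x, x \in W -> x != u -> 2 < deg x -> labeled_around m x ->
    exists q, [/\ q \in W, gadj x q, nbrs q \subset W & supports (want x) (m q)];
  wi_con : forall x, x \in W -> exists2 y, y \in W & gadj x y;
  wi_up : forall x, x \in W -> x \notin cnbhd [set v] -> parents x \subset W;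
  wi_tip : forall x, x \in W -> x \notin cnbhd [set v] -> x != u ->
    1 < #|nbrs x :&: W|;
  wi_u1 : u \notin cnbhd [set v] -> #|nbrs u :&: W| = 1 }.

Lemma mendable_sub W W' : W \subset W' -> mendable W -> mendable W'.
Proof.
by move=> /subsetP s [m [H1 H2 H3 H4]]; exists m; split=> // x /H4 /s.
Qed.

Lemma mendable_of W m : (forall x, m x != l x -> x \in W) ->
  (forall x, (m x == None) = (l x == None) && (x != v)) ->
  (forall x, labeled_around m x -> happy_at m x) -> mendable W.
Proof.
move=> H1 H2 H3; exists m; split=> //; first by rewrite H2 eqxx andbF.
by move=> x lx; rewrite H2 negb_and lx.
Qed.

Lemma violated W u m : walk_inv W u m -> ~ mendable W -> labeled_around m u /\ ~~ happy_at m u.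
Proof.
move=> I nm; case: (boolP (labeled_around m u && ~~ happy_at m u)) => [/andP //|H].
case: nm; apply: (mendable_of (wi_chg I) (wi_none I)) => x fx.
case: (eqVneq x u) => [xu|xu]; last exact: (wi_alm I).
by move: H; rewrite -xu fx /= negbK.
Qed.

Lemma upd_chg m y o W : (forall x, m x != l x -> x \in W) ->
  forall x, upd m y o x != l x -> x \in y |: W.
Proof.
move=> H x; rewrite updE !inE; case: (x == y) => //=; exact: H.
Qed.

Lemma upd_none m y o : (forall x, (m x == None) = (l x == None) && (x != v)) ->
  m y != None -> o != None ->
  forall x, (upd m y o x == None) = (l x == None) && (x != v).
Proof.
move=> H my oN x; rewrite updE -H; case: (x =P y) => // ->.
by rewrite (negbTE my) (negbTE oN).
Qed.

(** If taking over [y] yields no mend inside [y |: W], then [y] is an edge vertex and its other end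
    [z] is the only violated clause. It is unexplored, since explored clauses keep a support that
    takeovers leave alone, and it touches the explored part only in [y], since otherwise it could be
    satisfied by relabeling an explored neighbor. The second alternative on [y] serves the first
    step from a hole of degree at least 3, whose neighbors are already explored. *)
Lemma walk_step W u m y : walk_inv W u m -> ~ mendable (y |: W) -> gadj u y ->
  (y \notin W \/ u \in cnbhd [set v] /\ ~~ (nbrs y \subset W)) ->
  exists z, [/\ nbrs y = [set u; z], u != z, z \notin y |: W,
    nbrs z :&: (y |: W) = [set y]
    & walk_inv (z |: (y |: W)) z (upd m y (Some (Some (want u))))]
    /\ [/\ deg y <= 2, supports (want z) (m y), ~~ supports (want u) (m y) & m y != None].
Proof.
move=> I nm uy Hy.
have [fu nhu] : labeled_around m u /\ ~~ happy_at m u.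
  by apply: (violated I); apply: contra_not nm; apply: mendable_sub; apply: subsetUr.
have du := wi_deg I; have my : m y != None by apply: labeled_around_nbr uy.
have nsu q : gadj u q -> ~~ supports (want u) (m q).
  move=> uq; apply: contra nhu => sq; rewrite happy_at_big //; apply/supportedP.
  by exists q.
(* A support granted by [wi_sup] is explored together with all its neighbors, which fails for [y];
   so the takeover does not touch it. *)
have yncl q : q \in W -> nbrs q \subset W -> q != y.
  move=> qW qcl; apply: contraPneq Hy => <-; rewrite qW qcl /=.
  by case=> // -[].
have dy : deg y <= 2.
  rewrite leqNgt; apply/negP => dy; apply: nm.
  apply: (@mendable_of _ (upd m y (Some None))).
  - exact/upd_chg/(wi_chg I).
  - exact: upd_none (wi_none I) my _.
  - exact: almost_joker (wi_alm I) uy dy du my.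
set m' := upd m y (Some (Some (want u))).
have chg' : forall x, m' x != l x -> x \in y |: W by exact/upd_chg/(wi_chg I).
have none' : forall x, (m' x == None) = (l x == None) && (x != v).
  exact: upd_none (wi_none I) my _.
have [z /andP[fz nhz]] : exists z, labeled_around m' z && ~~ happy_at m' z.
  case: (pickP [pred z | labeled_around m' z && ~~ happy_at m' z]) => [z Hz|H]; first by exists z.
  case: nm.
  apply: (mendable_of chg' none') => x fx.
  by move: (H x); rewrite /= fx /= => /negbFE.
have [zu dz yz sz nz] := almost_flip (wi_alm I) uy dy du my fz nhz.
have Ny : nbrs y = [set u; z] by apply: deg2_nbrs; rewrite // 1?gadjC // eq_sym.
have fmz : labeled_around m z.
  by rewrite -(labeled_around_upd z (_ : (Some (Some (want u)) == None) = (m y == None)))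
    ?(negbTE my).
have alm' : almost m' z.
  move=> x xz fx; apply/negPn/negP => nhx.
  have [xu _ yx _ _] := almost_flip (wi_alm I) uy dy du my fx nhx.
  by move: yx; rewrite -in_nbrs Ny !inE (negbTE xu) (negbTE xz).
have m'o q : q != y -> m' q = m q by move=> qy; rewrite /m' updE (negbTE qy).
have zy : z != y by apply: contraTneq yz => ->; rewrite gadjxx.
have uny : u != y by apply: contraTneq uy => ->; rewrite gadjxx.
have zW : z \notin W.
  apply/negP => zW; have [q [qW zq qcl sq]] := wi_sup I zW zu dz fmz.
  by move: (nz _ zq); rewrite -/m' m'o ?sq //; apply: yncl.
have zW' : z \notin y |: W by rewrite !inE negb_or zy zW.
have Nz : nbrs z :&: (y |: W) = [set y].
  apply/setP => w; rewrite !inE; apply/idP/eqP => [/andP[zw]|->]; last first.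
    by rewrite eqxx gadjC yz.
  (* A second explored neighbor [w] of [z] would give a mend: by the joker if [w] is a clause, else
     by a takeover whose loser [x] would be explored and hence supported elsewhere. *)
  case/orP => [/eqP //|wW]; apply/eqP/negPn/negP => wy; apply: nm.
  have mw : m' w != None by apply: labeled_around_nbr fz zw.
  have nsw := nz _ zw; rewrite -/m' in nsw.
  have sub : forall o x, upd m' w o x != l x -> x \in y |: W.
    move=> o x; rewrite updE; case: (x =P w) => [->|_]; last exact: chg'.
    by rewrite !inE wW orbT.
  case: (leqP (deg w) 2) => dw; last first.
    apply: (mendable_of (sub _) (upd_none none' mw (_ : Some None != None))) => //.
    exact: almost_joker alm' zw dw dz mw.
  set m'' := upd m' w (Some (Some (want z))).
  apply: (mendable_of (sub _) (upd_none none' mw (_ : Some (Some (want z)) != None))) => //.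
  move=> x fx; apply/negPn/negP => nhx.
  have [xz dx wx _ nx] := almost_flip alm' zw dw dz mw fx nhx.
  have Nw : nbrs w = [set x; z] by apply: deg2_nbrs; rewrite // 1?gadjC // eq_sym.
  have xu : x != u.
    apply/eqP => xu; move: (nx y); rewrite xu uy !updE eq_sym (negbTE wy) eqxx.
    by rewrite /supports eqxx orbT => /(_ isT).
  have xW : x \in W.
    have [q qW] := wi_con I wW.
    by rewrite -in_nbrs Nw !inE => /orP[] /eqP qE; move: qW; rewrite qE // (negbTE zW).
  have fmx : labeled_around m x.
    rewrite -(labeled_around_upd x (_ : (Some (Some (want u)) == None) = (m y == None))) ?(negbTE my) //.
    by rewrite -(labeled_around_upd x (_ : (Some (Some (want z)) == None) = (m' w == None))) ?(negbTE mw).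
  have [q [qW xq qcl sq]] := wi_sup I xW xu dx fmx.
  move: (nx _ xq); rewrite updE; case: (q =P w) => [qw|_].
    by move/subsetP/(_ z): qcl; rewrite qw Nw !inE eqxx orbT (negbTE zW) => /(_ isT).
  by rewrite m'o ?sq //; apply: yncl.
exists z; split; last by split=> //; apply: nsu.
split=> //; first by rewrite eq_sym.
have sW : W \subset z |: (y |: W) by apply/subsetP => x xW; rewrite !inE xW !orbT.
have sW1 x : x \in W -> x \in z |: (y |: W) by apply/subsetP.
have zv : z \notin cnbhd [set v].
  apply: contra zW; rewrite in_cnbhd1 => /orP[/eqP ->|]; first exact: wi_v I.
  by rewrite -in_nbrs; apply/subsetP/(wi_Nv I).
have NyW : nbrs y \subset z |: (y |: W).
  apply/subsetP => x; rewrite Ny !inE => /orP[] /eqP ->; last by rewrite eqxx.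
  by rewrite (wi_u I) !orbT.
split=> //.
- exact/sW1/(wi_v I).
- exact: subset_trans (wi_Nv I) sW.
- by move=> x /chg' xW; rewrite inE xW orbT.
- by rewrite !inE eqxx.
- move=> x; rewrite 2!inE => /orP[/eqP -> |]; first by rewrite eqxx.
  rewrite in_setU1 => /orP[/eqP ->|xW]; first by rewrite ltnNge dy.
  move=> xz dx fx; case: (eqVneq x u) => [->|xu].
    exists y; split=> //; first by rewrite !inE eqxx orbT.
    by rewrite /m' updE eqxx /supports eqxx orbT.
  have fmx : labeled_around m x.
    by rewrite -(labeled_around_upd x (_ : (Some (Some (want u)) == None) = (m y == None))) ?(negbTE my).
  have [q [qW xq qcl sq]] := wi_sup I xW xu dx fmx.
  exists q; split=> //; [exact: sW1|exact: subset_trans qcl sW|].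
  by rewrite m'o //; apply: yncl.
- move=> x; rewrite 2!inE => /orP[/eqP -> |].
    by exists y; rewrite 1?gadjC // !inE eqxx orbT.
  rewrite in_setU1 => /orP[/eqP ->|/(wi_con I)[q qW xq]].
    by exists z; rewrite // !inE eqxx.
  by exists q; rewrite // sW1.
(* A neighbor that supported [z] in [l] supports it no longer, so its label has changed and it is
   explored. *)
- move=> x; rewrite 2!inE => /orP[/eqP -> _|].
    rewrite /parents leqNgt dz /=; apply/subsetP => q; rewrite inE => /andP[zq sq].
    rewrite inE; apply/orP; right; apply/negPn/negP => qW.
    have : m' q == l q by apply: contraNT qW; apply: chg'.
    by move/eqP => E; move: (nz _ zq); rewrite -/m' E sq.
  rewrite in_setU1 => /orP[/eqP -> _|xW xv]; last first.
    exact: subset_trans (wi_up I xW xv) sW.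
  apply: subset_trans NyW; rewrite /parents dy; apply/subsetP => q.
  by rewrite !inE => /and3P[].
- move=> x; rewrite 2!inE => /orP[/eqP -> _|]; first by rewrite eqxx.
  rewrite in_setU1 => /orP[/eqP -> _ _|xW xv xz].
    rewrite (_ : _ :&: _ = nbrs y); last exact/setIidPl.
    by rewrite Ny cards2 eq_sym zu.
  case: (eqVneq x u) => [xu|xu]; last first.
    apply: leq_trans (wi_tip I xW xv xu) _; apply: subset_leq_card.
    exact: setIS.
  have yW : y \notin W by case: Hy => // -[]; rewrite -xu (negbTE xv).
  have [a aW ua] := wi_con I (wi_u I).
  apply: leq_trans (_ : #|[set a; y]| <= _).
    by rewrite cards2; case: eqP aW yW => // -> ->.
  apply: subset_leq_card; apply/subsetP => q; rewrite xu !inE.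
  by case/orP => /eqP ->; rewrite ?ua ?uy ?aW ?eqxx ?orbT.
- move=> _; rewrite setIUr Nz (_ : nbrs z :&: [set z] = set0) ?set0U ?cards1 //.
  by apply/setP => q; rewrite !inE; case: eqP => [->|]; rewrite ?gadjxx ?andbF.
Qed.

End Walk.

(** * The first steps out of the hole *)

Section Start.
Variables (G : graph) (l : olabeling G) (v : vertex G).
Hypothesis lsol : forall x, labeled_around l x -> happy_at l x.
Implicit Types (m : olabeling G) (x y z u w q : vertex G) (W : {set vertex G}).

Notation B1 := (cnbhd [set v]).

Definition clause_state W u : Prop := u \notin B1 /\ exists m, walk_inv l v W u m.

(** The walk in the middle of a takeover: the edge vertex [y] is explored, while the clause [z] at
    its other end, the only continuation, is not. *)
Record edge_state W y : Prop := EdgeState {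
  es_y : y \in W;
  es_yv : y \notin B1;
  es_Nv : nbrs v \subset W;
  es_tip : forall x, x \in W -> x \notin B1 -> x != y -> 1 < #|nbrs x :&: W|;
  es_y1 : #|nbrs y :&: W| = 1;
  es_next : exists z, [/\ nbrs y :\: W = [set z], parents l z = [set y]
                        & clause_state (z |: W) z] }.

Lemma walk_inv_B1 W u m : walk_inv l v W u m -> B1 \subset W.
Proof.
move=> I; apply/subsetP => x; rewrite in_cnbhd1 => /orP[/eqP ->|]; first exact: wi_v I.
by rewrite -in_nbrs; apply/subsetP/(wi_Nv I).
Qed.

(** The vertices [y] and [z] were unexplored, so they still carry their labels from [l], and the
    links from [u] to [y] and from [y] to [z] can be read off [l] alone. *)
Lemma clause_next W u m y : walk_inv l v W u m -> ~ mendable l v (y |: W) ->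
  gadj u y -> y \notin W -> edge_state (y |: W) y /\ parents l y = [set u].
Proof.
move=> I nm uy yW; have [z [[Ny uz zW' Nz Iz] [dy sz nsu my]]] := walk_step I nm uy (or_introl yW).
have sB := subsetP (walk_inv_B1 I).
have yv : y \notin B1 by apply: contra yW => /sB.
have zv : z \notin B1 by apply: contra zW' => /sB; rewrite !inE => ->; rewrite orbT.
have ly : l y = m y by apply/esym/eqP; apply: contraNT yW => /(wi_chg I).
have ly' : l z = m z.
  by apply/esym/eqP; apply: contraNT zW' => /(wi_chg I); rewrite !inE => ->; rewrite orbT.
have zy : z != y by apply: contraNneq zW' => ->; rewrite !inE eqxx.
have NyW : nbrs y :&: (y |: W) = [set u].
  apply/setP => x; rewrite 2!inE Ny !inE; case: (eqVneq x u) => [->|_] /=.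
    by rewrite (wi_u I) orbT.
  by case: (eqVneq x z) => // ->; move: zW'; rewrite !inE => /negbTE ->.
split; last first.
  rewrite /parents dy; apply/setP => q; rewrite !inE -in_nbrs Ny ly !inE.
  case: (eqVneq q u) => [->|_] /=; first by rewrite (wi_deg I) nsu.
  by case: (eqVneq q z) => //= ->; rewrite sz andbF.
split=> //; first by rewrite !inE eqxx.
- by apply: subset_trans (wi_Nv I) _; exact: finset.subsetUr.
- move=> x; rewrite in_setU1 => /orP[/eqP ->|xW xv xy]; first by rewrite eqxx.
  case: (eqVneq x u) => [xu|xu]; last first.
    by apply: leq_trans (wi_tip I xW xv xu) _; apply/subset_leq_card/setIS/finset.subsetUr.
  have [a aW ua] := wi_con I (wi_u I).
  apply: leq_trans (_ : #|[set a; y]| <= _).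
    by rewrite cards2; case: eqP aW yW => // -> ->.
  apply: subset_leq_card; apply/subsetP => q; rewrite xu !inE.
  by case/orP => /eqP ->; rewrite ?ua ?uy ?aW ?eqxx ?orbT.
- by rewrite NyW cards1.
exists z; split; last by split=> //; eexists; exact: Iz.
- apply/setP => x; rewrite 2!inE Ny !inE; case: (eqVneq x u) => [->|_] /=.
    by rewrite (wi_u I) orbT (negbTE uz).
  by case: (eqVneq x z) => [->|]; rewrite ?andbF // andbT; move: zW'; rewrite !inE.
- have sup : parents l z \subset [set y].
    rewrite -Nz; apply/subsetP => q qz.
    have zq : gadj z q by move: qz; rewrite /parents leqNgt (wi_deg Iz) inE => /andP[].
    move/subsetP/(_ q qz): (wi_up Iz (wi_u Iz) zv); rewrite in_setU1 in_setI in_nbrs zq.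
    by case/orP => // /eqP qE; rewrite qE gadjxx in zq.
  apply/eqP; rewrite eqEsubset sup /=; apply/subsetP => q; rewrite inE => /eqP ->.
  by rewrite /parents leqNgt (wi_deg Iz) inE gadjC -in_nbrs Ny !inE eqxx orbT ly sz.
Qed.

(* The neighbors of the hole were not checked, so they may carry the joker
   illegally; such a label is replaced in favor of their other neighbor. *)
Definition start_label (b : bool) : olabeling G := [ffun x =>
  if x == v then (if deg v <= 2 then Some (Some b) else Some None)
  else if [&& gadj v x, deg x <= 2 & l x == Some None] then
    Some (Some (if [pick z | gadj x z && (z != v)] is Some z then want z else true))
  else l x].

Lemma start_none b x : (start_label b x == None) = (l x == None) && (x != v).
Proof.
rewrite ffunE; case: (eqVneq x v) => [->|xv]; first by rewrite andbF; case: ifP.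
by rewrite andbT; case: ifP => // /and3P[_ _ /eqP ->].
Qed.

Lemma start_chg b x : start_label b x != l x -> x \in B1.
Proof.
rewrite ffunE in_cnbhd1; case: (x =P v) => //= _; case: ifP => [/and3P[-> //]|].
by rewrite eqxx.
Qed.

Lemma start_full b x : ~~ gadj v x -> x != v -> labeled_around (start_label b) x -> labeled_around l x.
Proof.
move=> vx xv; rewrite (@eq_labeled_around _ _ l) // => y xy; rewrite start_none.
case: (eqVneq y v) xy => [->|_ _]; last by rewrite andbT.
by rewrite eq_sym (negbTE xv) gadjC (negbTE vx).
Qed.

(** The joker on a hole of degree at least 3 supports all neighboring clauses, so that only the hole
    itself can fail; the label [b] of a smaller hole fails only neighbors with the other wish. *)
Lemma start_happy b x : labeled_around (start_label b) x -> ~~ happy_at (start_label b) x ->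
  2 < deg x /\ (if deg v <= 2 then gadj v x && (b != want x) else x == v).
Proof.
move=> fx; case: (leqP (deg x) 2) => dx.
  rewrite /happy_at dx ffunE; case: (x =P v) => [xv|/eqP xv]; first by rewrite -xv dx.
  case: ifP => // vxl; case: (boolP (gadj v x)) vxl => vx vxl.
    by move: vxl; rewrite dx /= => ->.
  by have := lsol (start_full vx xv fx); rewrite /happy_at dx => ->.
rewrite happy_at_big // => nsx; split=> //.
have nq q : gadj x q -> ~~ supports (want x) (start_label b q).
  by move=> xq; apply: contra nsx => sq; apply/supportedP; exists q.
case: (eqVneq x v) => [xv|xv]; first by rewrite -xv leqNgt dx.
case: (boolP (gadj v x)) => vx /=.
  have := nq v; rewrite gadjC vx ffunE eqxx /supports => /(_ isT).
  by case: ifP => // _; apply: contra => /eqP ->; rewrite eqxx.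
have := lsol (start_full vx xv fx); rewrite happy_at_big // => /supportedP[q xq sq].
case/negP: (nq _ xq); rewrite ffunE; case: (q =P v) => [qv|/eqP qv].
  by rewrite -qv gadjC xq in vx.
case: ifP => // /and3P[vq dq _].
have Nq : nbrs q = [set v; x] by apply: deg2_nbrs; rewrite // 1?gadjC // eq_sym.
case: pickP => [z|/(_ x)]; last by rewrite gadjC xq xv.
rewrite -in_nbrs Nq !inE => /andP[/orP[/eqP ->|/eqP ->] //]; rewrite ?eqxx //.
by rewrite /supports eqxx orbT.
Qed.

Lemma start_inv_big : 2 < deg v -> walk_inv l v B1 v (start_label true).
Proof.
move=> dv; have dv' : deg v <= 2 = false by rewrite leqNgt dv.
have vB : v \in B1 by rewrite in_cnbhd1 eqxx.
have sN : nbrs v \subset B1 by apply/subsetP => x; rewrite in_nbrs in_cnbhd1 orbC => ->.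
have [a va] : exists a, gadj v a.
  have : 0 < #|nbrs v| by rewrite (leq_trans _ dv).
  by case/card_gt0P => a; rewrite in_nbrs; exists a.
split=> //.
- exact: start_chg.
- exact: start_none.
- move=> x xv fx; apply/negPn/negP => /(start_happy fx)[_].
  by rewrite dv' (negbTE xv).
- move=> x; rewrite in_cnbhd1 => /orP[/eqP ->|vx]; first by rewrite eqxx.
  move=> xv dx fx; exists v; split=> //; first by rewrite gadjC.
  by rewrite ffunE eqxx dv'.
- move=> x; rewrite in_cnbhd1 => /orP[/eqP ->|vx].
    by exists a; rewrite // in_cnbhd1 va orbT.
  by exists v; rewrite // gadjC.
- by move=> x ->.
- by move=> x ->.
- by rewrite vB.
Qed.

(** The hole sides with its neighbor other than [a], so only [a] can be left to repair. The choice
    of [a] is free: it is made later, according to the direction in which the exploration leaves the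
    ball. *)
Lemma start_small a : deg v <= 2 -> gadj v a ->
  mendable l v B1 \/ exists m, walk_inv l v B1 a m.
Proof.
move=> dv va.
(* [true] is a default for a hole whose only neighbor is [a]. *)
set b := if [pick c | gadj v c && (c != a)] is Some c then want c else true.
have vB : v \in B1 by rewrite in_cnbhd1 eqxx.
have sN : nbrs v \subset B1 by apply/subsetP => x; rewrite in_nbrs in_cnbhd1 orbC => ->.
have bE c : gadj v c -> c != a -> b = want c.
  move=> vc ca; have Nv : nbrs v = [set a; c] by apply: deg2_nbrs; rewrite // eq_sym.
  rewrite /b; case: pickP => [z|/(_ c)]; last by rewrite vc ca.
  by rewrite -in_nbrs Nv !inE => /andP[/orP[/eqP ->|/eqP ->] //]; rewrite ?eqxx.
have alm : almost (start_label b) a.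
  move=> x xa fx; apply/negPn/negP => /(start_happy fx)[_].
  by rewrite dv => /andP[vx]; rewrite (bE x) // eqxx.
case: (leqP (deg a) 2) => da.
  left; apply: (mendable_of (@start_chg b) (start_none b)) => x fx.
  apply/negPn/negP => nhx; have [dx] := start_happy fx nhx.
  by rewrite dv => /andP[vx]; rewrite (bE x) ?eqxx //; apply: contraTneq dx => ->; rewrite -leqNgt.
right; exists (start_label b); split=> //.
- exact: start_chg.
- exact: start_none.
- by rewrite in_cnbhd1 va orbT.
- move=> x; rewrite in_cnbhd1 => /orP[/eqP -> _|vx xa dx fx]; first by rewrite ltnNge dv.
  exists v; split=> //; first by rewrite gadjC.
  by rewrite ffunE eqxx dv (bE x) // /supports eqxx orbT.
- move=> x; rewrite in_cnbhd1 => /orP[/eqP ->|vx].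
    by exists a; rewrite // in_cnbhd1 va orbT.
  by exists v; rewrite // gadjC.
- by move=> x ->.
- by move=> x ->.
- by rewrite in_cnbhd1 va orbT.
Qed.

(** The vertex [a] between the hole and [x] decides. At a hole of degree at most 2, [a] is the
    clause to repair and [x] an edge to take over; at a larger hole, [a] is the edge already taken
    over and [x] its former owner. *)
Lemma start_next x : ~ mendable l v B1 -> x \in cnbhd B1 -> x \notin B1 ->
  [\/ mendable l v (x |: B1), clause_state (x |: B1) x | edge_state (x |: B1) x].
Proof.
move=> nm; rewrite in_cnbhd => /orP[-> //|/exists_inP[a aB ax] xB].
have va : gadj v a.
  by move: aB; rewrite in_cnbhd1 => /orP[/eqP av|//]; move: xB; rewrite -av in_cnbhd1 ax orbT.
have xv : x != v by apply: contraNneq xB => ->; rewrite in_cnbhd1 eqxx.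
case: (leqP (deg v) 2) => dv.
  have [//|[m I]] := start_small dv va.
  case: (pselect (mendable l v (x |: B1))) => [|nm']; first by constructor 1.
  by constructor 3; have [] := clause_next I nm' ax xB.
have I := start_inv_big dv; have aW : a |: B1 = B1 by apply/setUidPr; rewrite sub1set.
have [| |z [[Na vz zW _ Iz] _]] := walk_step I _ va; first by rewrite aW.
  right; split; first by rewrite in_cnbhd1 eqxx.
  by apply: contra xB => /subsetP/(_ x); apply; rewrite in_nbrs.
have xz : x = z by move: ax; rewrite -in_nbrs Na !inE (negbTE xv) => /eqP.
by constructor 2; subst z; split=> //; rewrite aW in Iz; eexists; exact: Iz.
Qed.
End Start.

(** * Descendants in the tree of possible walks *)

Lemma sum_card_disjoint (T : finType) (Y : {set T}) (A : T -> {set T}) (B : {set T}) :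
  (forall y, y \in Y -> A y \subset B) ->
  (forall y y' z, y \in Y -> y' \in Y -> z \in A y -> z \in A y' -> y = y') ->
  \sum_(y in Y) #|A y| <= #|B|.
Proof.
move=> sub dis; under eq_bigr => y _ do rewrite -sum1_card big_mkcond.
rewrite exchange_big -(sum1_card (mem B)) [leqRHS]big_mkcond; apply: leq_sum => z _ /=.
rewrite -big_mkcondr sum1dep_card.
case: ifP => zB; last first.
  rewrite leqn0 cards_eq0; apply/eqP/setP => y; rewrite !inE; apply/negP => /andP[yY].
  by move/(subsetP (sub y yY)); rewrite zB.
apply/card_le1_eqP => y y'; rewrite !inE => /andP[yY zy] /andP[yY' zy'].
exact: dis yY' yY zy' zy.
Qed.

Section Descendants.
Variables (G : graph) (l : olabeling G) (v : vertex G).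
Implicit Types (x y z u w q : vertex G) (W : {set vertex G}).

(** Depends on [l] and [v] only, so one relation serves all runs of the walk. *)
Definition child q y : bool := (y \notin cnbhd [set v]) && (parents l y == [set q]).

Definition desc x : {set vertex G} := [set y | connect child x y].

Lemma child_inj q q' y : child q y -> child q' y -> q = q'.
Proof. by move=> /andP[_ /eqP E] /andP[_]; rewrite E => /eqP/set1_inj. Qed.

Lemma connect_child_r x z : connect child x z ->
  x = z \/ exists2 q, child q z & connect child x q.
Proof.
move=> /connectP[p]; case/lastP: p => [_ -> //|p y]; first by left.
rewrite last_rcons rcons_path => /andP[px cy] ->; right.
by exists (last x p) => //; apply/connectP; exists p.
Qed.

Lemma desc_comparable x y z : connect child x z -> connect child y z ->
  connect child x y \/ connect child y x.
Proof.
move=> xz /connectP[p]; elim/last_ind: p z xz => [z xz _ zE|p c IH z xz].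
  by left; rewrite zE in xz.
rewrite rcons_path last_rcons => /andP[py cc] zE; subst c.
case: (connect_child_r xz) => [xE|[q qz xq]]; last first.
  by apply: (IH q) => //; apply: child_inj qz cc.
right; rewrite xE; apply: connect_trans (connect1 cc).
by apply/connectP; exists p.
Qed.

Lemma desc_out W y z : (forall x, x \in W -> x \notin cnbhd [set v] -> parents l x \subset W) ->
  y \notin W -> connect child y z -> z \notin W.
Proof.
move=> upW yW /connectP[p]; elim/last_ind: p z => [z _ -> //|p c IH z].
rewrite rcons_path last_rcons => /andP[py /andP[cB /eqP uc]] zE; subst c.
apply/negP => zW; have := upW z zW cB; rewrite uc sub1set.
by apply/negP; apply: IH.
Qed.

(** Distinct children of [u] have disjoint sets of descendants: if one descended from the other, so
    would its parent [u]; but [u] is explored, and descendants of an unexplored vertex are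
    unexplored. *)
Lemma desc_sum W u (Y : {set vertex G}) :
  (forall x, x \in W -> x \notin cnbhd [set v] -> parents l x \subset W) ->
  u \in W -> (forall y, y \in Y -> y \notin W /\ child u y) ->
  \sum_(y in Y) #|desc y| <= #|desc u|.
Proof.
move=> upW uW HY; apply: sum_card_disjoint => [y /HY[yW uy]|y y' z yY yY'].
  by apply/subsetP => z; rewrite !inE; apply: connect_trans; apply: connect1.
have key a b : a \in Y -> b \in Y -> connect child a b -> a = b.
  move=> /HY[aW _] /HY[_ ub] /connect_child_r[//|[q qb aq]].
  by have := desc_out upW aW aq; rewrite (child_inj qb ub) uW.
rewrite !inE => yz y'z; case: (desc_comparable yz y'z) => /key; first exact.
by move=> H; apply/esym/H.
Qed.

Lemma desc_child x y : child x y -> #|desc y| <= #|desc x|.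
Proof.
move=> xy; apply/subset_leq_card/subsetP => z; rewrite !inE.
exact/connect_trans/connect1.
Qed.

Lemma desc_gt0 x : 0 < #|desc x|.
Proof. by apply/card_gt0P; exists x; rewrite inE connect0. Qed.

End Descendants.

(* A state of the walk is only the set [W], so the tip of the walk has to be
   recovered from [W] *)
Definition frontier (v : nat) (W B : {fset nat}) (E : rel nat) : {fset nat} :=
  let Nv := [fset y in B | E v y]%fset in
  if ~~ (Nv `<=` W)%fset then (Nv `\` W)%fset else
  let tips := [fset x in W | [&& x != v, ~~ E v x & #|` [fset y in W | E x y]| == 1]]%fset in
  let T := [fset y in (B `\` W) | has (E^~ y) (enum_fset tips)]%fset in
  if T != fset0 then T else (B `\` W)%fset.

Lemma in_fset_sep (T : choiceType) (A : {fset T}) (P : pred T) a :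
  (a \in [fset x in A | P x]%fset) = (a \in A) && P a.
Proof. by rewrite in_fsetE. Qed.

(** * Recovering the tip from the explored set *)

Section Frontier.
Variables (G : graph) (v : vertex G).
Implicit Types (x y z u w q t : vertex G) (W : {set vertex G}).

Lemma mem_names W x : (fsval x \in names W) = (x \in W).
Proof.
apply/imfsetP/idP => [[y /= yW /val_inj -> //]|xW]; by exists x.
Qed.

Lemma namesP W (a : nat) : reflect (exists2 x, x \in W & a = fsval x) (a \in names W).
Proof.
apply: (iffP idP) => [/imfsetP[x /= xW ->]|[x xW ->]]; first by exists x.
by rewrite mem_names.
Qed.

Lemma names_inj : injective (@names G).
Proof. by move=> W W' E; apply/setP => x; rewrite -!mem_names E. Qed.

Lemma card_names W : #|` names W| = #|W|.
Proof. by rewrite card_imfset ?cardE //; apply: val_inj. Qed.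

Lemma names_setU1 y W : names (y |: W) = (fsval y |` names W)%fset.
Proof.
apply/fsetP => a; rewrite !(inE, in_fsetE); apply/namesP/orP => [[x]|[/eqP ->|/namesP[x xW ->]]].
- by rewrite !(inE, in_fsetE) => /orP[/eqP -> ->|xW ->]; [left|right; rewrite mem_names].
- by exists y; rewrite // !(inE, in_fsetE) eqxx.
- by exists x; rewrite // !(inE, in_fsetE) xW orbT.
Qed.

(** Uses names and visible edges only, so that states with the same view have literally the same
    frontier, as locality demands. *)
Definition view_adj W : rel nat := fun a b =>
  [&& a \in names (cnbhd W), b \in names (cnbhd W) & adj G a b].

Definition vfrontier W : {fset nat} :=
  frontier (fsval v) (names W) (names (cnbhd W)) (view_adj W).

Definition gfrontier W : {set vertex G} := [set y | fsval y \in vfrontier W].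

Lemma sub_cnbhd W : W \subset cnbhd W.
Proof. by apply/subsetP => x; rewrite in_cnbhd => ->. Qed.

Lemma nbrs_cnbhd W x y : x \in W -> gadj x y -> y \in cnbhd W.
Proof. by move=> xW xy; rewrite in_cnbhd; apply/orP; right; apply/exists_inP; exists x. Qed.

Lemma view_adjE W x y : x \in W -> view_adj W (fsval x) (fsval y) = gadj x y.
Proof.
move=> xW; rewrite /view_adj !mem_names (subsetP (sub_cnbhd W)) //=.
by apply/andP/idP => [[]//|xy]; split=> //; apply: nbrs_cnbhd xy.
Qed.

Lemma card_view W x : x \in W ->
  #|` [fset a in names W | view_adj W (fsval x) a]%fset| = #|nbrs x :&: W|.
Proof.
move=> xW; rewrite -card_names; congr (#|` _|); apply/fsetP => a; rewrite in_fset_sep.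
apply/andP/namesP => [[/namesP[y yW ->]]|[y]].
  by rewrite view_adjE // => xy; exists y; rewrite // !(inE, in_fsetE) xy.
by rewrite !(inE, in_fsetE) => /andP[xy yW] ->; rewrite view_adjE // mem_names.
Qed.

Lemma vfrontier_sub W a : a \in vfrontier W ->
  a \in names (cnbhd W) /\ a \notin names W.
Proof.
rewrite /vfrontier /frontier; case: ifP => _; last case: ifP => _; rewrite !(inE, in_fsetE) /=.
- by case/and3P => -> ->.
- by case/andP => /andP[-> ->].
- by case/andP => -> ->.
Qed.

Lemma names_gfrontier W : names (gfrontier W) = vfrontier W.
Proof.
apply/fsetP => a; apply/namesP/idP => [[y]|aF]; first by rewrite inE => yF ->.
have [/namesP[x _ aE] _] := vfrontier_sub aF.
by exists x; rewrite // inE -aE.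
Qed.

Lemma gfrontier_sub W y : y \in gfrontier W -> y \in cnbhd W /\ y \notin W.
Proof. by rewrite inE => /vfrontier_sub; rewrite !mem_names. Qed.

Lemma Nv_sub W : v \in W ->
  ([fset a in names (cnbhd W) | view_adj W (fsval v) a]%fset `<=` names W)%fset
  = (nbrs v \subset W).
Proof.
move=> vW; apply/fsubsetP/subsetP => [H y|H a].
  rewrite in_nbrs => vy; rewrite -mem_names; apply: H; rewrite in_fset_sep.
  by rewrite view_adjE // vy mem_names (nbrs_cnbhd vW).
rewrite in_fset_sep => /andP[/namesP[y yW ->]]; rewrite view_adjE // => vy.
by rewrite mem_names H // in_nbrs.
Qed.

Lemma gfrontier_start W y : v \in W -> ~~ (nbrs v \subset W) -> y \in gfrontier W ->
  gadj v y.
Proof.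
move=> vW vN; rewrite inE /vfrontier /frontier Nv_sub // vN !(inE, in_fsetE) /=.
by rewrite view_adjE // => /and3P[].
Qed.

(** Away from the hole, [t] is the only explored vertex with a single explored neighbor, hence the
    only tip that [frontier] finds. *)
Lemma gfrontier_tip W t : v \in W -> nbrs v \subset W -> t \in W ->
  t \notin cnbhd [set v] -> #|nbrs t :&: W| = 1 ->
  (forall x, x \in W -> x \notin cnbhd [set v] -> x != t -> 1 < #|nbrs x :&: W|) ->
  nbrs t :\: W != set0 -> gfrontier W = nbrs t :\: W.
Proof.
move=> vW vN tW tB t1 tips /set0Pn[c]; rewrite in_setD in_nbrs => /andP[cW tc].
set E := view_adj W; set B := names (cnbhd W).
have tipsE : [fset a in names W | [&& a != fsval v, ~~ E (fsval v) a &
    #|` [fset b in names W | E a b]| == 1]]%fset = [fset fsval t]%fset.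
  apply/fsetP => a; rewrite in_fset_sep in_fset1; apply/idP/eqP => [|->].
    case/and4P => /namesP[x xW ->]; rewrite /E view_adjE // card_view // => xv vx x1.
    congr fsval; apply/eqP; apply: contraTT x1 => xt.
    suff : 1 < #|nbrs x :&: W| by case: #|_| => // -[].
    by apply: tips => //; rewrite in_cnbhd1 negb_or vx andbT.
  rewrite mem_names tW /E view_adjE // card_view // t1 eqxx andbT /=.
  by move: tB; rewrite in_cnbhd1 negb_or.
have TE : [fset a in (B `\` names W) | has (E^~ a) (enum_fset [fset fsval t])]%fset
    = names (nbrs t :\: W).
  apply/fsetP => a; rewrite in_fset_sep in_fsetD.
  have hasE : has (E^~ a) (enum_fset [fset fsval t]%fset) = E (fsval t) a.
    apply/hasP/idP => [[b]|Ea]; first by rewrite /= in_fset1 => /eqP ->.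
    by exists (fsval t); rewrite // in_fset1.
  rewrite hasE; apply/andP/namesP => [[/andP[aW /namesP[y _ aE]]]|[y]].
    rewrite aE /E view_adjE // => ty; exists y => //.
    by rewrite in_setD in_nbrs ty andbT -mem_names -aE.
  rewrite in_setD in_nbrs => /andP[yW ty] ->; rewrite /E view_adjE // ty !mem_names yW.
  by rewrite (nbrs_cnbhd tW).
apply: names_inj; rewrite names_gfrontier /vfrontier /frontier Nv_sub // vN /=.
rewrite -/E -/B tipsE TE ifT //; apply/fset0Pn; exists (fsval c).
by rewrite mem_names in_setD cW in_nbrs.
Qed.

Lemma gfrontier_neq0 W : v \in W -> ~~ (cnbhd W \subset W) -> gfrontier W != set0.
Proof.
move=> vW /subsetPn[c cW cW'].
suff : vfrontier W != fset0.
  case/fset0Pn => a; rewrite -names_gfrontier => /namesP[x xF _].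
  by apply/set0Pn; exists x.
rewrite /vfrontier /frontier; case: ifP => [/fsubsetPn[a aN aW]|_].
  by apply/fset0Pn; exists a; rewrite in_fsetD aW.
case: ifP => // _; apply/fset0Pn; exists (fsval c).
by rewrite in_fsetD !mem_names cW cW'.
Qed.

End Frontier.

(** * Existence of mends *)

Section Existence.
Variables (G : graph) (l : olabeling G) (v : vertex G).
Hypothesis lsol : forall x, labeled_around l x -> happy_at l x.
Implicit Types (m : olabeling G) (x y z u w q : vertex G) (W : {set vertex G}).

Notation B1 := (cnbhd [set v]).

(** An isolated hole accepts its starting label. Around a hole of degree 1 or 2, no neighbor has
    room for degree 3. At a larger hole the joker supports all neighbors, so one of them can be
    relabeled in favor of the hole. *)
Lemma start_closed : cnbhd B1 \subset B1 -> mendable l v B1.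
Proof.
move=> /subsetP cl.
have clN y x : gadj v y -> gadj y x -> x != v -> gadj v x.
  move=> vy yx xv; have : x \in B1.
    by apply: cl; apply: nbrs_cnbhd yx; rewrite in_cnbhd1 vy orbT.
  by rewrite in_cnbhd1 (negbTE xv).
have [y vy|nv] := pickP (gadj v); last first.
  apply: (mendable_of (@start_chg _ l v true) (@start_none _ l v true)) => x fx.
  apply/negPn/negP => /(start_happy lsol fx)[dx]; rewrite nv; case: ifP => // _ /eqP xv.
  have : 0 < #|nbrs x| by apply: leq_trans dx.
  by case/card_gt0P => q; rewrite in_nbrs xv nv.
case: (leqP (deg v) 2) => dv.
  have [//|[m I]] := start_small lsol dv vy.
  have : nbrs y \subset v |: (nbrs v :\ y).
    apply/subsetP => x; rewrite !inE => yx; case: eqP => //= /eqP xv.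
    by rewrite (clN y) // andbT; apply: contraTneq yx => ->; rewrite gadjxx.
  move/subset_leq_card; rewrite cardsU1 !inE gadjxx andbF /=.
  have : #|nbrs v| = #|nbrs v :\ y|.+1 by rewrite (cardsD1 y) in_nbrs vy.
  have := wi_deg I; rewrite /deg => A B C; rewrite /deg B in dv.
  by have := leq_trans (leq_trans A C) dv.
have I := start_inv_big lsol dv; set m := start_label l v true in I.
case: (pselect (mendable l v B1)) => // nm.
have [fv _] := violated I nm; have my := labeled_around_nbr fv vy.
have yB : y \in B1 by rewrite in_cnbhd1 vy orbT.
have chg o x : upd m y o x != l x -> x \in B1.
  by move/(upd_chg (wi_chg I)); rewrite in_setU1 => /orP[/eqP ->|].
case: (leqP (deg y) 2) => dy.
  apply: (mendable_of (chg _) (upd_none (wi_none I) my (_ : Some (Some (want v)) != None))) => //.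
  move=> x fx; apply/negPn/negP => nhx.
  have [xv dx yx _ /(_ v)] := almost_flip (wi_alm I) vy dy dv my fx nhx.
  rewrite gadjC (clN y) // updE; case: eqP => [vE|_]; first by rewrite -vE gadjxx in vy.
  by rewrite /m ffunE eqxx leqNgt dv /supports eqxx => /(_ isT).
apply: (mendable_of (chg _) (upd_none (wi_none I) my (_ : Some None != None))) => //.
exact: almost_joker (wi_alm I) vy dy dv my.
Qed.

(** A clause has degree at least 3 and the tip has one explored neighbor. This is the branching on
    which the square root bound rests. *)
Lemma clause_next_ex W u : clause_state l v W u -> 1 < #|nbrs u :\: W|.
Proof.
case=> uB [m I]; have := wi_deg I; have := wi_u1 I uB.
by rewrite /deg -(cardsID W (nbrs u)) => ->; rewrite ltnS.
Qed.

(** Each takeover explores new vertices, so in a finite graph the walk must arrive at a mend. *)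
Lemma clause_mendable W u : clause_state l v W u -> exists W', mendable l v W'.
Proof.
move: {2}#|~: W| (leqnn #|~: W|) => k; elim/ltn_ind: k W u => k IH W u Wk cs.
have /card_gt0P[y] := ltnW (clause_next_ex cs); rewrite in_setD in_nbrs => /andP[yW uy].
case: (pselect (mendable l v (y |: W))) => [|nm]; first by exists (y |: W).
have [uB [m I]] := cs.
have [[_ _ _ _ _ [z [Nz _ cz]]] _] := clause_next I nm uy yW.
have zW : z \notin y |: W by have := set11 z; rewrite -Nz in_setD => /andP[].
apply: (IH #|~: (z |: (y |: W))| _ _ z _ cz) => //; apply: leq_trans Wk.
apply: leq_ltn_trans (_ : #|~: (y |: W)| < _).
  by apply/subset_leq_card; rewrite setCS; exact: finset.subsetUr.
apply: proper_card; rewrite properE setCS finset.subsetUr /=.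
by apply/subsetPn; exists y; rewrite !inE ?yW ?eqxx.
Qed.

Lemma mend_ex : exists W, mendable l v W.
Proof.
case: (pselect (mendable l v B1)) => [|nm]; first by exists B1.
have /subsetPn[x xc xB] : ~~ (cnbhd B1 \subset B1).
  by apply/negP => /start_closed.
case: (start_next lsol nm xc xB) => [|/clause_mendable //|]; first by eexists; eauto.
by case=> _ _ _ _ _ [z [_ _ /clause_mendable]].
Qed.

Lemma eq_happy_at W (m1 m2 : olabeling G) x :
  (forall y, (y == x) || gadj x y -> m1 y = m2 y) ->
  (labeled_around m1 x = labeled_around m2 x) * (happy_at m1 x = happy_at m2 x).
Proof.
move=> H; split; first by apply: eq_labeled_around => y /H ->.
rewrite /happy_at H ?eqxx //; case: ifP => // _; apply: eq_existsb => y.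
by case: (boolP (gadj x y)) => //= xy; rewrite H // xy orbT.
Qed.

(** [W] is a union of components, so any mend can be cut down to [W]. Hence a state without a mend
    has a nonempty frontier. *)
Lemma mendable_closed W : v \in W -> cnbhd W \subset W -> mendable l v W.
Proof.
move=> vW /subsetP cl; have [_ [m [mh mv mN _]]] := mend_ex.
pose m' : olabeling G := [ffun x => if x \in W then m x else l x].
have clx x y : (y == x) || gadj x y -> (y \in W) = (x \in W).
  case/orP => [/eqP -> //|xy]; apply/idP/idP => h; apply: cl.
    by apply: nbrs_cnbhd h _; rewrite gadjC.
  exact: nbrs_cnbhd h xy.
exists m'; split.
- move=> x; case: (boolP (x \in W)) => xW.
    have H y : (y == x) || gadj x y -> m' y = m y by move/clx => yW; rewrite ffunE yW xW.
    by rewrite !(eq_happy_at W H); apply: mh.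
  have H y : (y == x) || gadj x y -> m' y = l y.
    by move/clx => yW; rewrite ffunE yW (negbTE xW).
  by rewrite !(eq_happy_at W H); apply: lsol.
- by rewrite ffunE vW.
- by move=> x lx; rewrite ffunE; case: ifP => // _; apply: mN.
- by move=> x; rewrite ffunE; case: ifP => //; rewrite eqxx.
Qed.

End Existence.


(** * The infinite tree *)

(* Block [j] holds the clause [8 j], the edge vertices [8 j + 1 .. 8 j + 3] below
   it and the clauses [8 j + 4 .. 8 j + 6] below these; [8 j + 7] is the edge
   vertex above the clause [8 (j + 1)].  Hence clauses have 3 children at residue
   0 and 4 children at the residues 4 to 6. *)
Definition par (x : nat) : nat :=
  let r := x %% 8 in let j := x %/ 8 in
  if r == 0 then x.-1 else if r <= 3 then 8 * j else if r <= 6 then x - 3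
  else 8 * (j %/ 4 %/ 3) + 4 + (j %/ 4) %% 3.

Definition kids (x : nat) : seq nat :=
  let r := x %% 8 in let j := x %/ 8 in
  if r == 0 then [:: x + 1; x + 2; x + 3] else if r <= 3 then [:: x + 3]
  else if r <= 6 then
    let k := 3 * j + (r - 4) in
    [:: 32 * k + 7; 32 * k + 15; 32 * k + 23; 32 * k + 31]
  else [:: x + 1].

Lemma par_lt x : 0 < x -> par x < x.
Proof. by rewrite /par; case: ifP; [|case: ifP; [|case: ifP]]; lia. Qed.

Lemma mem_kids x y : (y \in kids x) = (0 < y) && (par y == x).
Proof.
apply/idP/idP.
  rewrite /kids /par; case: ifP; [|case: ifP; [|case: ifP]]; rewrite !inE;
  move=> *; repeat case: ifP; lia.
rewrite /kids /par; case: (y %% 8 =P 0) => ?;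
  [|case: (leqP (y %% 8) 3) => ?; [|case: (leqP (y %% 8) 6) => ?]];
move=> /andP[? /eqP <-]; rewrite /kids; repeat case: ifP; rewrite !inE; lia.
Qed.

Lemma kids_uniq x : uniq (kids x).
Proof. by rewrite /kids; repeat case: ifP => //; rewrite /= !inE; lia. Qed.

Definition tnbrs x : seq nat := (if 0 < x then [:: par x] else [::]) ++ kids x.

Definition tadj : rel nat := fun x y => ((0 < x) && (par x == y)) || ((0 < y) && (par y == x)).

Lemma mem_tnbrs x y : (y \in tnbrs x) = tadj x y.
Proof.
rewrite mem_cat mem_kids /tadj; congr orb.
by case: ifP => _; rewrite ?inE // eq_sym.
Qed.

Lemma tnbrs_uniq x : uniq (tnbrs x).
Proof.
rewrite /tnbrs cat_uniq kids_uniq andbT; case: ifP => // x0 /=; last by rewrite has_pred0.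
apply/hasPn => y; rewrite mem_kids inE => /andP[y0 /eqP yx].
by have := par_lt y0; have := par_lt x0; lia.
Qed.

Lemma tadjC : symmetric tadj.
Proof. by move=> x y; rewrite /tadj orbC. Qed.

Lemma tadjxx x : tadj x x = false.
Proof. by rewrite /tadj orbb; apply/negP => /andP[/par_lt h /eqP E]; rewrite E ltnn in h. Qed.

(** * Finite subtrees and their labeling *)

Section Tgraph.
Variable S : {fset nat}.

Definition sadj : rel nat := fun x y => [&& x \in S, y \in S & tadj x y].

Lemma sadj_sym : symmetric sadj.
Proof. by move=> x y; rewrite /sadj tadjC andbCA. Qed.

Lemma sadj_irr : irreflexive sadj.
Proof. by move=> x; rewrite /sadj tadjxx !andbF. Qed.

Lemma sadj_vset x y : sadj x y -> x \in S.
Proof. by case/and3P. Qed.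

Definition tgraph : graph := Graph sadj_sym sadj_irr sadj_vset.

Lemma gadj_tgraph (x y : vertex tgraph) : gadj x y = tadj (fsval x) (fsval y).
Proof. by rewrite /gadj /= /sadj !fsvalP. Qed.

Lemma deg_tgraph (x : vertex tgraph) : deg x = count [in S] (tnbrs (fsval x)).
Proof.
rewrite /deg cardE -(size_map (@fsval _ S)) -size_filter; apply/perm_size/uniq_perm.
- by rewrite map_inj_uniq ?enum_uniq //; apply: val_inj.
- exact/filter_uniq/tnbrs_uniq.
move=> a; rewrite mem_filter mem_tnbrs; apply/mapP/andP => [[y]|[aS xa]].
  by rewrite mem_enum inE gadj_tgraph => xy ->; split=> //; apply: fsvalP.
by exists [` aS]%fset => //; rewrite mem_enum inE gadj_tgraph.
Qed.

Definition tclosed : Prop := 0 \in S /\ forall x, x \in S -> 0 < x -> par x \in S.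

(** Parents have smaller numbers, so both cycle neighbors of the largest vertex on a cycle would be
    its parent. *)
Lemma tgraph_acyclic (s : seq (vertex tgraph)) : 2 < size s -> ~ ucycle (@gadj tgraph) s.
Proof.
move=> s2 /andP[cs us]; have [x0 x0s] : exists x0, x0 \in s.
  by case: s s2 {cs us} => // x0 s _; exists x0; rewrite mem_head.
have [m ms mmax] := @arg_maxnP _ x0 [in s] (@fsval _ S) x0s.
have [i s' sE] := rot_to ms.
have par_m (x : vertex tgraph) : x \in s -> gadj m x -> par (fsval m) = fsval x.
  move=> xs; rewrite gadj_tgraph => /orP[/andP[_ /eqP //]|/andP[/par_lt h /eqP E]].
  by move: h (mmax _ xs); rewrite E /=; lia.
have us' : uniq (m :: s') by rewrite -sE rot_uniq.
have cs' : cycle (@gadj tgraph) (m :: s') by rewrite -sE rot_cycle.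
have s2' : 2 < size (m :: s') by rewrite -sE size_rot.
have mem_s x : x \in m :: s' -> x \in s by rewrite -sE mem_rot.
case: s' => [|a [|b s']] // in us' cs' s2' mem_s sE.
move: cs'; rewrite /= rcons_path => /and3P[ma ab /andP[_ lm]].
move: us'; rewrite /= => /and3P[_ anb _].
have lb : last b s' \in b :: s' by rewrite mem_last.
have lbs : last b s' \in [:: m, a, b & s'] by rewrite 2!in_cons lb !orbT.
have abs : a \in [:: m, a, b & s'] by rewrite !inE eqxx orbT.
have E1 := par_m a (mem_s a abs) ma; have E2 := par_m (last b s') (mem_s _ lbs).
case/negP: anb; rewrite (_ : a = last b s') //; apply: val_inj => /=.
by rewrite -E1 -E2 // gadjC.
Qed.

Hypothesis Sc : tclosed.

Lemma tgraph_tree : tree tgraph.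
Proof.
have [S0 Sp] := Sc; split; last exact: tgraph_acyclic.
  by rewrite /gsize /= cardfs_gt0; apply/fset0Pn; exists 0.
have root (x : vertex tgraph) : connect (@gadj tgraph) x [` S0]%fset.
  have [n] := ubnP (fsval x); elim: n x => // n IH x xn.
  case: (posnP (fsval x)) => [x0|x0].
    by rewrite (_ : x = [` S0]%fset) //; apply: val_inj.
  have pS := Sp _ (fsvalP x) x0.
  apply: connect_trans (connect1 _) (IH [` pS]%fset _).
    by rewrite gadj_tgraph /tadj x0 eqxx.
  by apply: leq_trans (par_lt x0) _; rewrite -ltnS.
have sym := sym_connect_sym (@gadjC tgraph).
move=> x y; apply: connect_trans (root x) _; rewrite sym; exact: root.
Qed.

Lemma size_kids x : size (kids x) <= 4.
Proof. by rewrite /kids; repeat case: ifP. Qed.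

Lemma tgraph_degree : degree_le 5 tgraph.
Proof.
move=> x; rewrite -[#|_|]/(deg x) deg_tgraph; apply: leq_trans (count_size _ _) _.
rewrite size_cat; apply: (@leq_add _ _ 1 4); last exact: size_kids.
by case: ifP.
Qed.

(** An edge of residue 7 lies above a clause of full degree 4, which wants [true]; the edges of
    residues 1 to 3 lie above clauses of full degree 5, which want [false]. So every edge belongs to
    its lower end. *)
Definition tlabel : olabeling tgraph :=
  [ffun x => if fsval x == 0 then None else Some (Some (fsval x %% 8 == 7))].

(** Cutting the tree can lower a degree from 5 to 3 or 4 and so turn a wish into [true]; but then a
    remaining edge below the clause has residue 7 and supports it. All other clauses are supported
    from above. *)
Lemma tlabel_happy (x : vertex tgraph) : labeled_around tlabel x -> happy_at tlabel x.
Proof.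
have [S0 Sp] := Sc; move=> fx; have := labeled_around_self fx; rewrite ffunE.
case: (posnP (fsval x)) => [//|x0 _].
case: (leqP (deg x) 2) => dx; first by rewrite /happy_at dx ffunE; case: ifP.
rewrite happy_at_big //; apply/supportedP.
have pS := Sp _ (fsvalP x) x0; pose p : vertex tgraph := [` pS]%fset.
have xp : gadj x p by rewrite gadj_tgraph /tadj x0 eqxx.
have := labeled_around_nbr fx xp; rewrite ffunE /=; case: (par (fsval x) =P 0) => // p0 _.
have lp : tlabel p = Some (Some (par (fsval x) %% 8 == 7)).
  by rewrite ffunE /=; case: (par (fsval x) =P 0).
have dE := deg_tgraph x; have ds : deg x <= size (tnbrs (fsval x)).
  by rewrite dE count_size.
rewrite /tnbrs x0 /= in dE ds; rewrite pS in dE.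
have [d5|d5] := ltnP (deg x) 5; last first.
  exists p => //; rewrite lp /want ltnNge d5 /supports.
  suff /negbTE -> : par (fsval x) %% 8 != 7 by rewrite eqxx.
  move: ds; rewrite /par /kids; case: ifP; [|case: ifP; [|case: ifP]] => /=; lia.
have [E|E] := eqVneq (fsval x %% 8) 0.
  exists p => //; rewrite lp /want d5 /supports.
  suff -> : par (fsval x) %% 8 == 7 by rewrite eqxx.
  by move: E; rewrite /par; case: ifP; lia.
have /hasP[y yk yS] : has [in S] (kids (fsval x)).
  by rewrite has_count; move: dx; rewrite dE; case: (count _ _).
pose q : vertex tgraph := [` yS]%fset; exists q.
  change (is_true (gadj x q)).
  by rewrite gadj_tgraph -mem_tnbrs /tnbrs mem_cat /= yk orbT.
rewrite ffunE /= /want d5 /supports.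
suff [-> ->] : (y == 0) = false /\ y %% 8 == 7 by rewrite eqxx.
move: ds dx yk; rewrite /kids (negbTE E); case: ifP; [|case: ifP]; rewrite /= ?inE; lia.
Qed.

End Tgraph.

(** For a rooted subtree this is its closed neighborhood in the infinite tree. *)
Definition add_kids (W : {fset nat}) : {fset nat} :=
  [fset y in enum_fset W ++ flatten [seq kids x | x <- enum_fset W]]%fset.

Lemma mem_add_kids W y : (y \in add_kids W) = (y \in W) || ((0 < y) && (par y \in W)).
Proof.
rewrite /add_kids in_fset mem_cat; congr orb.
apply/flatten_mapP/andP => [[x xW]|[y0 pW]].
  by rewrite mem_kids => /andP[-> /eqP ->].
by exists (par y); rewrite // mem_kids y0 eqxx.
Qed.

Lemma sub_add_kids W : (W `<=` add_kids W)%fset.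
Proof. by apply/fsubsetP => x; rewrite mem_add_kids => ->. Qed.

Lemma add_kids_mono W W' : (W `<=` W')%fset -> (add_kids W `<=` add_kids W')%fset.
Proof.
move=> /fsubsetP s; apply/fsubsetP => x; rewrite !mem_add_kids => /orP[/s -> //|/andP[-> /s ->]].
by rewrite orbT.
Qed.

Lemma card_add_kids W : #|` add_kids W| <= 5 * #|` W|.
Proof.
rewrite /add_kids card_fseq; apply: leq_trans (size_undup _) _.
rewrite size_cat mulSn leq_add // size_flatten /shape -map_comp.
elim: (enum_fset W) => //= x s IH; rewrite mulnS leq_add //; exact: size_kids.
Qed.

Lemma tclosed_add_kids W : tclosed W -> tclosed (add_kids W).
Proof.
case=> W0 Wp; split; first by rewrite mem_add_kids W0.
move=> x; rewrite !mem_add_kids => /orP[xW x0|/andP[_ pW _]]; last by rewrite pW.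
by rewrite (Wp x xW x0).
Qed.

Lemma tclosed_between W W' : tclosed W -> (W `<=` W')%fset -> (W' `<=` add_kids W)%fset ->
  tclosed W'.
Proof.
move=> [W0 Wp] /fsubsetP s /fsubsetP e; split; first exact: s.
move=> x /e; rewrite mem_add_kids => /orP[/Wp h /h|/andP[_]]; last by move=> h _; apply: s.
exact: s.
Qed.

(** The parent of the least missing number is smaller and hence present, so vertices can be added
    one at a time. *)
Lemma tclosed_pad k S : tclosed S ->
  exists S', [/\ tclosed S', (S `<=` S')%fset & #|` S'| = #|` S| + k].
Proof.
move=> Sc; elim: k => [|k [S' [[S0 Sp] SS' cS']]]; first by exists S; rewrite addn0.
have ex : exists x, x \notin S'.
  exists (\max_(x <- enum_fset S') x).+1; apply/negP => h.
  by have := @leq_bigmax_seq _ (enum_fset S') xpredT id _ h isT; rewrite ltnn.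
case: (ex_minnP ex) => x xS xmin.
have x0 : 0 < x by rewrite lt0n; apply: contraNneq xS => ->.
exists (x |` S')%fset; split.
- split; first by rewrite in_fset1U S0 orbT.
  move=> y; rewrite !in_fset1U => /orP[/eqP -> _|yS y0]; last by rewrite Sp ?orbT.
  case: (boolP (par x \in S')) => [_|/xmin]; first by rewrite orbT.
  by rewrite leqNgt par_lt.
- by apply: fsubset_trans SS' _; apply: fsubsetU1.
- by rewrite cardfsU1 xS cS' addnS add1n.
Qed.

Definition clause_vertex (c : nat) : bool := (c %% 8 == 0) || (3 < c %% 8 <= 6).

Definition edge_vertex (e : nat) : bool := (0 < e %% 8 <= 3) || (e %% 8 == 7).

Lemma clause_kids c e : clause_vertex c -> e \in kids c ->
  edge_vertex e /\ (e %% 8 == 7) = (c %% 8 != 0).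
Proof.
rewrite /kids /clause_vertex /edge_vertex; case: ifP; [|case: ifP; [|case: ifP]].
- by rewrite !inE; lia.
- by lia.
- by rewrite !inE; lia.
- by lia.
Qed.

Lemma edge_kids e : edge_vertex e -> exists c,
  [/\ kids e = [:: c], clause_vertex c & (c %% 8 == 0) = (e %% 8 == 7)].
Proof.
rewrite /edge_vertex /clause_vertex /kids.
case: ifP; [lia|case: ifP => [e3 e0 _|e3 e0 e7]].
  by exists (e + 3); split=> //; lia.
by rewrite ifF; [exists (e + 1); split=> //; lia|lia].
Qed.

(** * Explored sets inside a larger subtree *)

Section Window.
Variables (S Wn : {fset nat}).
Hypotheses (Sc : tclosed S) (Wc : tclosed Wn) (WS : (add_kids (add_kids Wn) `<=` S)%fset).

Definition window : {set vertex (tgraph S)} := [set x | fsval x \in Wn].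

Let eS : (add_kids Wn `<=` S)%fset.
Proof. exact: fsubset_trans (sub_add_kids _) WS. Qed.

Lemma names_window : names window = Wn.
Proof.
apply/fsetP => a; apply/namesP/idP => [[x]|aW]; first by rewrite inE => xW ->.
have aS : a \in S by apply/(fsubsetP eS)/(fsubsetP (sub_add_kids _)).
by exists ([` aS]%fset : vertex (tgraph S)); rewrite // inE.
Qed.

Lemma names_cnbhd_window : names (cnbhd window) = add_kids Wn.
Proof.
apply/fsetP => a; apply/namesP/idP => [[x]|aW].
  rewrite in_cnbhd mem_add_kids => + ->; rewrite inE => /orP[-> //|/exists_inP[y]].
  rewrite inE gadj_tgraph => yW /orP[/andP[y0 /eqP E]|/andP[x0 /eqP E]].
    by case: Wc => _ /(_ _ yW y0); rewrite E => ->.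
  by rewrite x0 E yW orbT.
have aS : a \in S by apply/(fsubsetP eS).
pose x : vertex (tgraph S) := [` aS]%fset; exists x => //.
move: aW; rewrite mem_add_kids => /orP[aW|/andP[a0 pW]].
  by rewrite in_cnbhd inE aW.
have pS : par a \in S by apply/(fsubsetP eS)/(fsubsetP (sub_add_kids _)).
pose p : vertex (tgraph S) := [` pS]%fset.
by apply: (@nbrs_cnbhd _ _ p); rewrite ?inE // gadj_tgraph /tadj a0 eqxx orbT.
Qed.

(* Rerouting the hole's constraint flips an unexplored edge below every clause
   vertex of the window, so the set of flipped edges would be infinite *)
Lemma window_not_mendable v : fsval v = 0 -> ~ mendable (tlabel S) v window.
Proof.
move=> v0 [m [mh mv mN mW]].
have mE x : m x != None.
  case: (eqVneq x v) => [-> //|xv]; apply: mN; rewrite ffunE; case: (fsval x =P 0) => // x0.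
  by case/eqP: xv; apply: val_inj; rewrite /= x0 v0.
have mhappy x : happy_at m x by apply: mh; apply/forall_inP.
(* [Q c] says that the edge above the clause [c], if any, is labeled against it. Then an edge below
   [c] must support it. The label of that edge differs from [tlabel], so it lies in [Wn], and the
   clause below it satisfies [Q] again. *)
pose Q c := [&& c \in add_kids Wn & clause_vertex c] /\
  (0 < c -> forall q, fsval q = par c -> m q = Some (Some (c %% 8 != 0))).
have step c : Q c -> exists2 c', c < c' & Q c'.
  move=> [/andP[cE cl] Hc]; have cS := fsubsetP eS _ cE.
  pose x : vertex (tgraph S) := [` cS]%fset.
  (* The second layer of [add_kids] gives each clause of [add_kids Wn] its full degree, and thus the
     wish belonging to its residue. *)
  have allS y : y \in tnbrs c -> y \in S.
    rewrite mem_tnbrs => /orP[/andP[c0 /eqP <-]|/andP[y0 /eqP E]].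
      by case: Sc => _; apply.
    by apply: (fsubsetP WS); rewrite mem_add_kids y0 E cE orbT.
  have dx : deg x = size (tnbrs c).
    by rewrite deg_tgraph; apply/eqP; rewrite -all_count; apply/allP.
  have [d3 wx] : 2 < deg x /\ want x = (c %% 8 == 0).
    rewrite /want dx /tnbrs /kids; move: cl; rewrite /clause_vertex.
    case: (posnP c) => [->|c0] //=; case: ifP => //=; case: ifP => //=; first lia.
    by case: ifP => //=; lia.
  have := mhappy x; rewrite happy_at_big // => /supportedP[y]; rewrite gadj_tgraph -mem_tnbrs.
  rewrite wx mem_cat => /orP[yp|yk] sy.
    move: yp; case: ifP => // c0; rewrite inE => /eqP /(Hc c0 y) mq; move: sy.
    by rewrite mq /supports; case: (c %% 8 == 0).
  rewrite [fsval x]/= in yk; have yk' := yk; rewrite mem_kids in yk'; case/andP: yk' => y0 /eqP py.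
  have [ye ylab] := clause_kids cl yk; have [c' [kE c'cl c'lab]] := edge_kids ye.
  have dy : deg y <= 2.
    rewrite deg_tgraph; apply: leq_trans (count_size _ _) _.
    by rewrite /tnbrs y0 size_cat kE.
  have my : m y = Some (Some (c %% 8 == 0)).
    by have := mhappy y; rewrite /happy_at dy; move: sy => /orP[/eqP -> //|/eqP].
  have yW : fsval y \in Wn.
    have : y \in window by apply: mW; rewrite my ffunE (gtn_eqF y0); rewrite ylab; case: (c %% 8 == 0).
    by rewrite inE.
  have : c' \in kids (fsval y) by rewrite kE mem_head.
  rewrite mem_kids => /andP[c'0 /eqP c'y].
  have cc' : c < c' by apply: ltn_trans (par_lt c'0); rewrite c'y -py par_lt.
  exists c' => //; split; first by rewrite mem_add_kids c'0 c'y yW orbT.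
  by move=> _ q; rewrite c'y => /val_inj ->; rewrite my c'lab ylab negbK.
have all_n n : exists2 c, n <= c & Q c.
  elim: n => [|n [c nc /step[c' cc' Qc']]]; last by exists c' => //; apply: leq_ltn_trans cc'.
  by exists 0 => //; split=> //; rewrite mem_add_kids; case: Wc => ->.
have [c] := all_n (\max_(x <- enum_fset S) x).+1; rewrite ltnNge => /negP nc [/andP[cE _] _].
apply: nc; apply: (@leq_bigmax_seq _ (enum_fset S) xpredT id) => //.
exact: (fsubsetP eS).
Qed.

End Window.

Local Open Scope ring_scope.

(** * The random mender *)

Section Kernel.
Variables (R : realType) (gc : graph -> Prop) (gcD : exists D, forall G, gc G -> degree_le D G).
Notation P := (sinkless gcD).

Lemma contains_mendP (G : graph) (l : olabeling G) v W :
  reflect (mendable l v W) (@contains_mend P G l v W).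
Proof.
apply: (iffP existsP) => [[m /andP[/and3P[/forallP s mv /forallP mN] /subsetP c]]|].
  exists m; split=> // [x fx|x lx|x mx].
  - exact: implyP (s x) fx.
  - exact: implyP (mN x) lx.
  - by apply: c; rewrite inE.
move=> [m [mh mv mN c]]; exists m; apply/andP; split; last first.
  by apply/subsetP => x; rewrite inE; apply: c.
apply/and3P; split=> //; apply/forallP => x; apply/implyP; [exact: mh|exact: mN].
Qed.

Lemma hole_instanceP (G : graph) (l : olabeling G) v :
  @hole_instance P G l v -> l v = None /\ forall x, labeled_around l x -> happy_at l x.
Proof.
move=> /andP[/forallP s /eqP lv]; split=> // x fx; exact: implyP (s x) fx.
Qed.

Lemma sinkless_mends : mends_exist P.
Proof.
move=> G l v _ /hole_instanceP[lv ls]; have [W] := mend_ex v ls.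
by move/contains_mendP => /existsP[m /andP[mm _]]; exists m.
Qed.

(** Phrased with names, so that states with the same view get the same probabilities. *)
Definition walk_kernel : kernels R P := fun G l v W U =>
  if contains_mend (P := P) l v W then (U == W)%:R
  else (names U \in [fset (a |` names W)%fset | a in vfrontier v W]%fset)%:R
       / #|` vfrontier v W|%:R.

Section At_instance.
Variables (G : graph) (l : labeling (lab P) G) (v : vertex G).
Implicit Types (W U : {set vertex G}).

Lemma walk_kernel_mend W U : mendable l v W -> walk_kernel l v W U = (U == W)%:R.
Proof. by move=> /contains_mendP cm; rewrite /walk_kernel cm. Qed.

Lemma walk_kernel_nomend W U : ~ mendable l v W ->
  walk_kernel l v W U = (U \in [set y |: W | y in gfrontier v W])%:R / #|gfrontier v W|%:R.
Proof.
move=> nm; have /negbTE cm : ~~ contains_mend (P := P) l v W by apply/contains_mendP.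
rewrite /walk_kernel cm -names_gfrontier card_names.
congr (_%:R / _); apply: congr1; apply/imfsetP/imsetP => [[a /= /namesP[y yF ->]]|[y yF ->]].
  by rewrite -names_setU1 => /names_inj ->; exists y.
by exists (fsval y) => /=; rewrite ?mem_names // names_setU1.
Qed.

Lemma walk_kernel_ge0 W U : 0 <= walk_kernel l v W U.
Proof. by rewrite /walk_kernel; case: ifP => _; rewrite ?divr_ge0 ?ler0n. Qed.

Lemma walk_kernel_sum W (f : {set vertex G} -> R) : ~ mendable l v W ->
  \sum_U walk_kernel l v W U * f U
  = (\sum_(y in gfrontier v W) f (y |: W)) / #|gfrontier v W|%:R.
Proof.
move=> nm; under eq_bigr => U _ do rewrite walk_kernel_nomend // mulrAC.
rewrite -mulr_suml; congr (_ / _).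
rewrite -(big_imset (h := fun y => y |: W) f) /=; last first.
  move=> y y' /gfrontier_sub[_ yW] /gfrontier_sub[_ yW'] /setP/(_ y).
  by rewrite setU11 in_setU1 (negbTE yW) orbF => /esym/eqP.
rewrite [RHS]big_mkcond /=; apply: eq_bigr => U _.
by case: ifP => _; rewrite ?mul1r ?mul0r.
Qed.

Lemma walk_kernel_sum_mend W (f : {set vertex G} -> R) : mendable l v W ->
  \sum_U walk_kernel l v W U * f U = f W.
Proof.
move=> nm; under eq_bigr => U _ do rewrite walk_kernel_mend //.
rewrite (bigD1 W) //= eqxx mul1r big1 ?addr0 // => U /negbTE ->.
by rewrite mul0r.
Qed.

Lemma walk_kernel_gt0 W U : 0 < walk_kernel l v W U ->
  [/\ W \subset U, U \subset cnbhd W & U != W -> exists2 y, y \in gfrontier v W & U = y |: W].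
Proof.
case: (pselect (mendable l v W)) => [nm|nm].
  rewrite walk_kernel_mend //; case: (U =P W) => [->|_]; last by rewrite ltxx.
  by split=> //; apply: sub_cnbhd.
rewrite walk_kernel_nomend //; case: imsetP => [[y yF ->] _|_]; last by rewrite mul0r ltxx.
split; [exact: finset.subsetUr| |by exists y].
by rewrite subUset sub1set sub_cnbhd andbT; have [] := gfrontier_sub yF.
Qed.

Lemma walk_kernel_stay W : ~ mendable l v W -> walk_kernel l v W W = 0.
Proof.
move=> nm; rewrite walk_kernel_nomend //; case: imsetP => [[y yF WE]|]; last by rewrite mul0r.
by have [_] := gfrontier_sub yF; rewrite WE !inE eqxx.
Qed.

End At_instance.

Lemma same_view_frontier (G : graph) (l : labeling (lab P) G) v W
    (G' : graph) (l' : labeling (lab P) G') v' W' :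
  same_view l v W l' v' W' -> vfrontier v W = vfrontier v' W'.
Proof.
case=> vv WW BB aa _; rewrite /vfrontier vv WW BB; congr frontier.
apply/funext => a; apply/funext => b; rewrite /view_adj -BB.
by case: (boolP (a \in _)) => //= ha; case: (boolP (b \in _)) => //= hb; apply: aa.
Qed.

Lemma walk_mender : is_mender walk_kernel.
Proof.
split.
- by move=> *; apply: walk_kernel_ge0.
- move=> G l v W _ /hole_instanceP[lv ls] vW.
  under eq_bigr => U _ do rewrite -[walk_kernel _ _ _ _]mulr1.
  case: (pselect (mendable l v W)) => nm.
    by rewrite (walk_kernel_sum_mend (fun=> 1) nm).
  rewrite (walk_kernel_sum (fun=> 1) nm) sumr_const divff // pnatr_eq0 cards_eq0.
  by apply: gfrontier_neq0 => //; apply/negP => /(mendable_closed ls vW).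
- by move=> G l v W U _ _ _ /walk_kernel_gt0[].
- by move=> G l v W U _ _ _ /walk_kernel_gt0[].
- move=> G l v W _ _ vW; split=> [M1|/contains_mendP cm]; last first.
    by rewrite walk_kernel_mend ?eqxx.
  apply/contains_mendP; case: (pselect (mendable l v W)) => // nm.
  by move: M1; rewrite walk_kernel_stay // => /esym/eqP; rewrite oner_eq0.
- move=> G l v W G' l' v' W' _ _ _ _ _ _ /negbTE nm /negbTE nm' sv U U' UU.
  rewrite /walk_kernel nm nm' UU (same_view_frontier sv).
  by case: sv => _ -> _ _ _.
Qed.

End Kernel.

(** * Concavity of the square root *)

Section Sqrt.
Variable R : realType.

(* [sqrt d <= (d / t + t) / 2] with [t = 3 s / 4] *)
Lemma sqrt_tangent (d s : R) : 0 <= d -> 0 < s ->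
  Num.sqrt d <= 2 / 3 * d / s + 3 / 8 * s.
Proof.
move=> d0 s0; rewrite -[in leRHS](sqr_sqrtr d0); set r := Num.sqrt d.
have : 0 <= (r - 3 / 4 * s) ^+ 2 * (2 / 3 / s).
  by rewrite mulr_ge0 ?sqr_ge0 // divr_ge0 ?(ltW s0) //; lra.
suff -> : (r - 3 / 4 * s) ^+ 2 * (2 / 3 / s) = 2 / 3 * r ^+ 2 / s + 3 / 8 * s - r by lra.
by field; rewrite gt_eqF.
Qed.

(** With [s = sqrt d >= 1] and [k >= 2] children, the tangent bound gives at most
    [(2 + 3 + 8 / 3) * s * k], which is below [8 * s * k]. The summand [2] pays for an edge vertex
    and the clause behind it. *)
Lemma sum_sqrt_le (T : finType) (A : {set T}) (g : T -> nat) (d : nat) :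
  (1 < #|A|)%N -> (0 < d)%N -> (\sum_(y in A) g y <= d)%N ->
  \sum_(y in A) (2 + 8 * Num.sqrt (g y)%:R) <= 8 * Num.sqrt d%:R * #|A|%:R :> R.
Proof.
move=> A1 d0 gd; set s : R := Num.sqrt d%:R; set k : R := #|A|%:R.
have s1 : 1 <= s by rewrite /s -[leLHS]sqrtr1 ler_sqrt ?ler1n ?ler0n.
have k2 : 2 <= k by rewrite /k ler_nat.
have s0 : 0 < s by lra.
apply: (@le_trans _ _ (\sum_(y in A) (2 + 8 * (2 / 3 * (g y)%:R / s + 3 / 8 * s)))).
  by apply: ler_sum => y _; have := @sqrt_tangent (g y)%:R s (ler0n _ _) s0; lra.
rewrite (eq_bigr (fun y => (2 + 3 * s) + 16 / 3 / s * (g y)%:R)); last first.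
  by move=> y _; field; rewrite gt_eqF.
rewrite big_split /= sumr_const -mulr_sumr -natr_sum -mulr_natr -/k.
have : 16 / 3 / s * (\sum_(y in A) g y)%:R <= 16 / 3 * s.
  have -> : 16 / 3 * s = 16 / 3 / s * d%:R.
    by rewrite -[d%:R]sqr_sqrtr ?ler0n // -/s; field; rewrite gt_eqF.
  by rewrite ler_wpM2l ?ler_nat // divr_ge0 ?(ltW s0) //; lra.
by nra.
Qed.
End Sqrt.

(** * Expected size of the explored set *)

Section Bound.
Variables (R : realType) (gc : graph -> Prop) (gcD : exists D, forall G, gc G -> degree_le D G).
Notation P := (sinkless gcD).
Notation M := (@walk_kernel R gc gcD).
Variables (G : graph) (l : labeling (lab P) G) (v : vertex G).
Hypothesis lsol : forall x, labeled_around l x -> happy_at l x.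
Implicit Types (x y z u w q : vertex G) (W U : {set vertex G}).

Definition mean_size t W : R := \sum_U steps M l v t W U * #|U|%:R.

Lemma mean_size0 W : mean_size 0 W = #|W|%:R.
Proof.
rewrite /mean_size (bigD1 W) //= eqxx mul1r big1 ?addr0 // => U /negbTE.
by rewrite eq_sym => ->; rewrite mul0r.
Qed.

Lemma mean_sizeS t W : mean_size t.+1 W = \sum_U M l v W U * mean_size t U.
Proof.
rewrite /mean_size /=; under eq_bigr => U _ do rewrite mulr_suml.
rewrite exchange_big /=; apply: eq_bigr => U _.
by rewrite mulr_sumr; apply: eq_bigr => U' _; rewrite mulrA.
Qed.

Definition mean_bounded W b : Prop := forall t, mean_size t W <= b.

Lemma mean_bounded_le W b c : b <= c -> mean_bounded W b -> mean_bounded W c.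
Proof. by move=> bc H t; apply: le_trans bc. Qed.

Lemma mean_bounded_mend W : mendable l v W -> mean_bounded W #|W|%:R.
Proof.
move=> mw; elim=> [|t IH]; first by rewrite mean_size0.
by rewrite mean_sizeS (walk_kernel_sum_mend _ mw).
Qed.

Lemma mean_bounded_step W b (f : vertex G -> R) : ~ mendable l v W ->
  gfrontier v W != finset.set0 -> #|W|%:R <= b ->
  (forall y, y \in gfrontier v W -> mean_bounded (y |: W) (f y)) ->
  \sum_(y in gfrontier v W) f y <= b * #|gfrontier v W|%:R -> mean_bounded W b.
Proof.
move=> nm F0 Wb fb fs [|t]; first by rewrite mean_size0.
rewrite mean_sizeS (walk_kernel_sum _ nm) ler_pdivrMr; last by rewrite ltr0n card_gt0.
by apply: le_trans fs; apply: ler_sum => y /fb; apply.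
Qed.

Lemma cardC_setU1 y W : y \notin W -> #|~: W| = #|~: (y |: W)|.+1.
Proof.
move=> yW; have := cardsC W; have := cardsC (y |: W); rewrite cardsU1 yW add1n.
by move=> <-; rewrite addSnnS; apply: addnI.
Qed.

Lemma natr_cardU1 y W : y \notin W -> #|y |: W|%:R = #|W|%:R + 1 :> R.
Proof. by move=> yW; rewrite cardsU1 yW addnC natrD. Qed.

(** The bound is a potential that does not grow in expectation. From a clause, [sum_sqrt_le] trades
    the loss in the square root for the two vertices to be explored; at an edge vertex, the extra 1
    is the forced next clause. The induction is on the number of unexplored vertices. *)
Lemma mean_bounded_walk k :
  (forall W u, (#|~: W| <= k)%N -> clause_state l v W u ->
     mean_bounded W (#|W|%:R + 8 * Num.sqrt (#|desc l v u|)%:R)) /\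
  (forall W y, (#|~: W| <= k)%N -> edge_state l v W y ->
     mean_bounded W (#|W|%:R + 1 + 8 * Num.sqrt (#|desc l v y|)%:R)).
Proof.
elim/ltn_ind: k => k IH; split=> W u Wk cs; have sq0 := sqrtr_ge0 (#|desc l v u|%:R : R).
  case: (pselect (mendable l v W)) => nm.
    by apply: mean_bounded_le (mean_bounded_mend nm); lra.
  have [uB [m I]] := cs; have N1 := clause_next_ex cs.
  have FE : gfrontier v W = nbrs u :\: W.
    apply: gfrontier_tip (wi_v I) (wi_Nv I) (wi_u I) uB (wi_u1 I uB) (wi_tip I) _.
    by rewrite -card_gt0 ltnW.
  (* A neighbor that completes a mend stops the walk and need not be a [child] of [u], so it is
     charged no descendants. *)
  pose g y := if `[< mendable l v (y |: W) >] then 0%N else #|desc l v y|.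
  apply: (@mean_bounded_step _ _ (fun y => #|W|%:R + (2 + 8 * Num.sqrt (g y)%:R))) => //.
  - by rewrite FE -card_gt0 ltnW.
  - by lra.
  - move=> y; rewrite FE in_setD in_nbrs => /andP[yW uy].
    rewrite /g; case: asboolP => nmy.
      apply: mean_bounded_le (mean_bounded_mend nmy).
      by rewrite natr_cardU1 // sqrtr0; lra.
    have [es _] := clause_next I nmy uy yW.
    have ck := cardC_setU1 yW.
    have [_ H] := IH #|~: (y |: W)| (leq_trans (eq_leq (esym ck)) Wk).
    apply: mean_bounded_le (H _ _ (leqnn _) es).
    by rewrite natr_cardU1 //; lra.
  rewrite FE big_split /= sumr_const mulrDl mulr_natr lerD2l.
  apply: sum_sqrt_le => //; first exact: desc_gt0.
  rewrite (eq_bigr (fun y => if ~~ `[< mendable l v (y |: W) >] then #|desc l v y| else 0%N)); last first.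
    by move=> y _; rewrite /g; case: ifP.
  rewrite -big_mkcondr /=.
  pose Y := [set y in nbrs u :\: W | ~~ `[< mendable l v (y |: W) >]].
  rewrite (eq_bigl [in Y]); last by move=> y; rewrite !inE.
  apply: desc_sum (wi_up I) (wi_u I) _ => y.
  rewrite /Y inE in_setD in_nbrs => /andP[/andP[yW uy] /asboolPn nmy]; split=> //.
  have [es uE] := clause_next I nmy uy yW.
  by rewrite /child (es_yv es) uE eqxx.
case: (pselect (mendable l v W)) => nm.
  by apply: mean_bounded_le (mean_bounded_mend nm); lra.
have [z [Nz uz cz]] := es_next cs.
have zB : z \notin cnbhd [set v] by case: cz.
have zW : z \notin W by have := set11 z; rewrite -Nz in_setD => /andP[].
have vW : v \in W.
  case: cz => _ [m I]; have := wi_v I; rewrite in_setU1 => /orP[/eqP vz|//].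
  by move: zB; rewrite -vz in_cnbhd1 eqxx.
have FE : gfrontier v W = [set z].
  rewrite -Nz; apply: gfrontier_tip vW (es_Nv cs) (es_y cs) (es_yv cs) (es_y1 cs) (es_tip cs) _.
  by rewrite Nz -card_gt0 cards1.
have ck := cardC_setU1 zW.
have [H _] := IH #|~: (z |: W)| (leq_trans (eq_leq (esym ck)) Wk).
have dzu : Num.sqrt (#|desc l v z|%:R : R) <= Num.sqrt #|desc l v u|%:R.
  by rewrite ler_sqrt ?ler0n // ler_nat desc_child // /child zB uz eqxx.
apply: (@mean_bounded_step _ _ (fun y => #|W|%:R + 1 + 8 * Num.sqrt #|desc l v u|%:R)) => //.
- by rewrite FE -card_gt0 cards1.
- by lra.
- move=> y; rewrite FE inE => /eqP ->.
  by apply: mean_bounded_le (H _ _ (leqnn _) cz); rewrite natr_cardU1 //; lra.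
by rewrite FE big_set1 cards1 mulr1.
Qed.

Hypothesis deg5 : degree_le 5 G.

(** The ball around the hole has at most 6 vertices and is explored first. One more vertex starts
    the walk, and the potential of an [edge_state] adds 1, which makes 8. *)
Lemma mean_bounded_start W : v \in W -> W \subset cnbhd [set v] ->
  mean_bounded W (8 + 8 * Num.sqrt (gsize G)%:R).
Proof.
have n1 : 0 <= Num.sqrt (gsize G)%:R :> R by exact: sqrtr_ge0.
have cB : (#|cnbhd [set v]| <= 6)%N.
  rewrite (_ : cnbhd _ = v |: nbrs v); first by rewrite cardsU1 -add1n leq_add ?leq_b1 ?deg5.
  by apply/setP => x; rewrite in_cnbhd1 in_setU1 in_nbrs.
move: {2}#|~: W| (leqnn #|~: W|) => k; elim/ltn_ind: k W => k IH W Wk vW WB.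
have W6 : #|W|%:R <= 6%:R :> R by rewrite ler_nat (leq_trans (subset_leq_card WB)).
case: (pselect (mendable l v W)) => nm.
  by apply: mean_bounded_le (mean_bounded_mend nm); lra.
have F0 : gfrontier v W != finset.set0.
  by apply: gfrontier_neq0 => //; apply/negP => /(mendable_closed lsol vW).
apply: (@mean_bounded_step _ _ (fun=> 8 + 8 * Num.sqrt (gsize G)%:R)) => //.
- by lra.
- move=> y yF; have [yc yW] := gfrontier_sub yF.
  case: (boolP (nbrs v \subset W)) => vN; last first.
    have vy := gfrontier_start vW vN yF.
    apply: (IH #|~: (y |: W)|) => //.
    - by rewrite -(cardC_setU1 yW).
    - by rewrite in_setU1 vW orbT.
    - by rewrite subUset sub1set WB andbT in_cnbhd1 vy orbT.
  have WE : W = cnbhd [set v].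
    apply/eqP; rewrite eqEsubset WB; apply/subsetP => x.
    by rewrite in_cnbhd1 -in_nbrs => /orP[/eqP -> //|/(subsetP vN)].
  have dn x : Num.sqrt #|desc l v x|%:R <= Num.sqrt (gsize G)%:R :> R.
    by rewrite ler_sqrt ?ler0n // ler_nat (leq_trans (max_card _)) // /gsize cardfE.
  have := dn y; rewrite WE in nm yc yW *; have c7 : #|y |: cnbhd [set v]|%:R <= 7%:R :> R.
    by rewrite ler_nat cardsU1; apply: leq_add (leq_b1 _) cB.
  case: (start_next lsol nm yc yW) => cs dy.
  - by apply: mean_bounded_le (mean_bounded_mend cs); lra.
  - have [H _] := mean_bounded_walk #|~: (y |: cnbhd [set v])|.
    by apply: mean_bounded_le (H _ _ (leqnn _) cs); lra.
  - have [_ H] := mean_bounded_walk #|~: (y |: cnbhd [set v])|.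
    by apply: mean_bounded_le (H _ _ (leqnn _) cs); lra.
by rewrite sumr_const mulr_natr.
Qed.

Lemma steps_ge0 t W U : 0 <= steps M l v t W U.
Proof.
elim: t W => [|t IH] W /=; first by rewrite ler0n.
by apply: sumr_ge0 => U' _; rewrite mulr_ge0 ?walk_kernel_ge0.
Qed.

Lemma walk_kernel_sum_le1 W : \sum_U M l v W U <= 1.
Proof.
under eq_bigr => U _ do rewrite -[walk_kernel _ _ _ _]mulr1.
case: (pselect (mendable l v W)) => nm; first by rewrite (walk_kernel_sum_mend (fun=> 1) nm).
rewrite (walk_kernel_sum (fun=> 1) nm) sumr_const.
by have [->|k0] := eqVneq (#|gfrontier v W|%:R : R) 0; rewrite ?invr0 ?mulr0 ?ler01 ?divff.
Qed.

Lemma steps_le1 t W U : steps M l v t W U <= 1.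
Proof.
elim: t W => [|t IH] W /=; first by rewrite lern1 leq_b1.
apply: le_trans (walk_kernel_sum_le1 W); apply: ler_sum => U' _.
by rewrite ler_piMr ?walk_kernel_ge0.
Qed.

(** An absorbing state only gains probability; as this stays below 1, [limit_dist] is a genuine
    limit. *)
Lemma steps_nd W U : M l v U U = 1 -> nondecreasing_seq (fun t => steps M l v t W U).
Proof.
move=> U1; apply/nondecreasing_seqP => t; elim: t W => [|t IH] W.
  case: (eqVneq W U) => [->|WU]; last by rewrite [leLHS]/= (negbTE WU) steps_ge0.
  rewrite [leLHS]/= eqxx /= (bigD1 U) //= U1 eqxx mul1r lerDl.
  by apply: sumr_ge0 => U' _; rewrite mulr_ge0 ?walk_kernel_ge0 ?ler0n.
rewrite [leLHS]/= [leRHS]/=; apply: ler_sum => U' _.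
by apply: ler_wpM2l; rewrite ?walk_kernel_ge0 //; apply: IH.
Qed.

(** At each time the states of [A] contribute at most the mean size, and a finite sum passes to the
    limit. *)
Lemma limit_sum_le W b (A : {set {set vertex G}}) : mean_bounded W b ->
  (forall U, U \in A -> M l v U U = 1) ->
  \sum_(U in A) limit_dist M l v W U * #|U|%:R <= b.
Proof.
move=> bW A1.
have cv U : U \in A ->
    ((fun t => steps M l v t W U * #|U|%:R) @ \oo --> limit_dist M l v W U * #|U|%:R)%classic.
  move=> /A1 U1; apply: cvgMr_tmp; apply: nondecreasing_is_cvgn; first exact: steps_nd.
  by exists 1 => _ [t _ <-]; apply: steps_le1.
have cs := @cvg_big _ _ _ 0 [in A] (@add_continuous R) nat eventually (index_enum _) _ _ _ cv.
apply: (cvgr_to_le (cs _)); apply: nearW => t; apply: le_trans (bW t).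
rewrite /mean_size [leRHS](bigID [in A]) /= lerDl.
by apply: sumr_ge0 => U _; rewrite mulr_ge0 ?steps_ge0 ?ler0n.
Qed.

End Bound.

(** * Upper bounds on the two volumes *)

Section Volumes.
Variables (R : realType) (gc : graph -> Prop).
Hypothesis gc5 : forall G, gc G -> degree_le 5 G.

Lemma gc_bounded : exists D, forall G, gc G -> degree_le D G.
Proof. by exists 5. Qed.

Notation P := (sinkless gc_bounded).
Notation M := (@walk_kernel R gc gc_bounded).

Lemma EMVol_walk G : gc G -> EMVol M G <= 8 + 8 * Num.sqrt (gsize G)%:R.
Proof.
move=> gG; have n0 : 0 <= Num.sqrt (gsize G)%:R :> R := sqrtr_ge0 _.
apply: bigmax_le => [|[l v] /= /hole_instanceP[lv ls]]; first lra.
apply: limit_sum_le; last by move=> U; rewrite inE => /andP[/eqP].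
refine (@mean_bounded_start R _ _ G l v ls (gc5 gG) _ (set11 v) _).
by rewrite sub1set in_cnbhd1 eqxx.
Qed.

Lemma EMVol_o : has_o P (@EMVol R) (fun n => n%:R).
Proof.
exists M; split; first exact: walk_mender.
(* Beyond this threshold [16 / e <= sqrt n], hence [8 + 8 * sqrt n <= 16 * sqrt n <= e * n]. *)
move=> e e0; exists (Num.truncn ((16 / e) ^+ 2)).+1 => G gG nG.
apply: le_trans (EMVol_walk gG) _; set n : R := (gsize G)%:R; set s := Num.sqrt n.
have n1 : 1 <= n by rewrite /n ler1n (leq_trans _ nG).
have nE : n = s ^+ 2 by rewrite sqr_sqrtr // /n ler0n.
have s1 : 1 <= s by rewrite /s -[leLHS]sqrtr1 ler_sqrt // /n ler0n.
have s16 : 16 / e <= s.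
  rewrite -[leLHS]gtr0_norm ?divr_gt0 // -sqrtr_sqr ler_sqrt ?ler0n //.
  apply: le_trans (_ : (Num.truncn ((16 / e) ^+ 2)).+1%:R <= _); last by rewrite ler_nat.
  by apply: ltW; apply: truncnS_gt.
have es : 16 <= e * s by rewrite mulrC -ler_pdivrMr.
by rewrite nE expr2 mulrA; nra.
Qed.

Lemma DMVol_O : has_O P (@DMVol R) (fun n => n%:R).
Proof.
exists M; split; first exact: walk_mender.
exists 1, 0%N; split=> // G _ _; rewrite mul1r /DMVol ler_nat.
apply/bigmax_leqP => i _; apply/bigmax_leqP => W _.
by rewrite (leq_trans (max_card _)) // /gsize cardfE.
Qed.

End Volumes.

(** * The adversary *)

Section Mender.
Variables (R : realType) (P : lcl) (M : kernels R P).
Hypothesis Mm : is_mender M.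
Variables (G : graph) (l : labeling (lab P) G) (v : vertex G).
Hypotheses (gG : gclass P G) (hv : hole_instance l v).

(** Without a mend, termination forbids staying with probability 1, so another state has positive
    probability; by progress it is larger. *)
Lemma mender_moves (W : {set vertex G}) : v \in W -> ~~ contains_mend l v W ->
  exists2 U : {set vertex G}, W \proper U & 0 < M l v W U.
Proof.
move=> vW nm; case: (pickP [pred U : {set vertex G} | (U != W) && (0 < M l v W U)]) => [U /andP[UW MU]|no].
  exists U => //; rewrite properEneq eq_sym UW.
  exact: mender_progress MU.
case/negP: nm; apply/(mender_termination Mm gG hv vW).
have := mender_sum1 Mm gG hv vW; rewrite (bigD1 W) //= big1 ?addr0 // => U UW.
have := no U; rewrite /= UW /= => /negbT; rewrite -leNgt => le0.
by apply/eqP; rewrite eq_le le0 (mender_ge0 Mm).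
Qed.

Lemma mender_ends (W : {set vertex G}) : v \in W -> exists U : {set vertex G},
  [/\ W \subset U, M l v U U = 1 & connect (fun A B : {set vertex G} => 0 < M l v A B) W U].
Proof.
move: {2}#|~: W| (leqnn #|~: W|) => k; elim/ltn_ind: k W => k IH W Wk vW.
case: (boolP (contains_mend l v W)) => cm.
  by exists W; split; rewrite ?connect0 //; apply/(mender_termination Mm gG hv vW).
have [U WU MU] := mender_moves vW cm.
have vU : v \in U by apply: subsetP (proper_sub WU) _ vW.
have [|U' [UU' MU' cU]] := IH #|~: U| _ U (leqnn _) vU.
  by apply: leq_trans Wk; apply: proper_card; rewrite properC.
exists U'; split=> //; first exact: subset_trans (proper_sub WU) UU'.
exact: connect_trans (connect1 _) cU.
Qed.

(** The explored set grows only finitely often, so every reachable state lies in a reachable final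
    one. *)
Lemma DMVol_ge (W : {set vertex G}) : connect (fun A B : {set vertex G} => 0 < M l v A B) [set v] W ->
  v \in W -> (#|W|%:R : R) <= DMVol M G.
Proof.
move=> cW vW; have [U [WU MU cU]] := mender_ends vW; rewrite ler_nat.
apply: leq_trans (@leq_bigmax_cond _ _ _ (l, v) hv).
apply: leq_trans (subset_leq_card WU) _; apply: leq_bigmax_cond.
by rewrite inE MU eqxx (connect_trans cW).
Qed.

End Mender.

(** * A linear lower bound for every mender *)

Section Omega.
Variables (R : realType) (gc : graph -> Prop).
Variable gcD : exists D, forall G, gc G -> degree_le D G.
Hypothesis gct : forall G, tree G -> degree_le 5 G -> gc G.
Notation P := (sinkless gcD).
Variable M : kernels R P.
Hypothesis Mm : is_mender M.

Lemma tgraph_gc S : tclosed S -> gclass P (tgraph S).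
Proof. by move=> Sc; apply: gct; [apply: tgraph_tree|apply: tgraph_degree]. Qed.

Lemma tgraph_hole S (v : vertex (tgraph S)) : tclosed S -> fsval v = 0%N ->
  @hole_instance P (tgraph S) (tlabel S) v.
Proof.
move=> Sc v0; apply/andP; split; last by rewrite ffunE v0.
by apply/forallP => x; apply/implyP => fx; apply: (tlabel_happy Sc).
Qed.

(** Quantifying over all trees with two more layers around [Wn] fixes the run first and leaves the
    tree to be cut off later. *)
Definition reached (Wn : {fset nat}) : Prop := tclosed Wn /\
  forall S, tclosed S -> (add_kids (add_kids Wn) `<=` S)%fset ->
  forall v : vertex (tgraph S), fsval v = 0%N ->
    connect (fun A B : {set vertex (tgraph S)} =>
      0 < M (tlabel S : labeling (lab P) _) v A B) [set v] (window S Wn).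

Lemma reached0 : reached [fset 0%N]%fset.
Proof.
split; first by split=> [|x]; rewrite in_fset1 // => /eqP ->.
move=> S Sc eS v v0; rewrite (_ : window _ _ = [set v]) ?connect0 //.
by apply/setP => x; rewrite [LHS]inE in_fset1 [RHS]inE -v0.
Qed.

(** The move is found in the smallest admissible tree. In a larger one the window has the same view
    and again contains no mend, so by locality the move is equally probable there. *)
Lemma reached_step Wn : reached Wn ->
  exists Wn', [/\ (Wn `<` Wn')%fset, (Wn' `<=` add_kids Wn)%fset & reached Wn'].
Proof.
move=> [Wc Wr]; set S := add_kids (add_kids Wn).
have Sc : tclosed S by do 2!apply: tclosed_add_kids.
have SS : (add_kids (add_kids Wn) `<=` S)%fset by [].
pose v : vertex (tgraph S) := [` Sc.1]%fset; have v0 : fsval v = 0%N by [].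
have vW T (u : vertex (tgraph T)) : fsval u = 0%N -> u \in window T Wn.
  by move=> u0; rewrite inE u0; case: Wc.
have hS := tgraph_hole Sc v0; have gS := tgraph_gc Sc.
have nmS : ~~ @contains_mend P _ (tlabel S) v (window S Wn).
  by apply/contains_mendP; apply: window_not_mendable.
have [U WU MU] := mender_moves Mm gS hS (vW _ _ v0) nmS.
have UE : (names U `<=` add_kids Wn)%fset.
  rewrite -(names_cnbhd_window Wc SS); apply/fsubsetP => a /namesP[x xU ->].
  rewrite mem_names; apply: subsetP xU.
  exact: (mender_exploration Mm gS hS (vW _ _ v0) MU).
have WnU : (Wn `<` names U)%fset.
  rewrite fproperEneq -{1 2}(names_window SS); apply/andP; split.
    by apply/eqP => /names_inj E; move: WU; rewrite E properxx.
  apply/fsubsetP => a /namesP[x xW ->]; rewrite mem_names.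
  exact: subsetP (proper_sub WU) _ xW.
exists (names U); split=> //; split.
  exact: tclosed_between Wc (fproper_sub WnU) UE.
move=> T Tc eT w w0.
have eTW : (add_kids (add_kids Wn) `<=` T)%fset.
  by apply: fsubset_trans eT; apply/add_kids_mono/add_kids_mono/fproper_sub.
apply: connect_trans (Wr T Tc eTW w w0) (connect1 _).
have UT : (names U `<=` T)%fset.
  by apply: fsubset_trans eT; apply: fsubset_trans (sub_add_kids _) (sub_add_kids _).
rewrite -(mender_locality Mm gS hS (vW _ _ v0) (tgraph_gc Tc) (tgraph_hole Tc w0)
  (vW _ _ w0) nmS _ _ (U := U)) //.
- by apply/contains_mendP; apply: window_not_mendable.
- split; rewrite ?(names_cnbhd_window Wc) ?names_window ?w0 //.
  + move=> a b aE bE; rewrite /= /sadj.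
    have sS : (add_kids Wn `<=` S)%fset := sub_add_kids _.
    have sT : (add_kids Wn `<=` T)%fset := fsubset_trans sS eTW.
    by rewrite !(fsubsetP sS) // !(fsubsetP sT).
  + by move=> x x' _ E; rewrite !ffunE E.
- apply/fsetP => a; apply/idP/namesP => [aU|[x]]; last by rewrite inE => xU ->.
  have aT : a \in T by apply: (fsubsetP UT).
  by exists ([` aT]%fset : vertex (tgraph T)); rewrite // inE.
Qed.

(** A step enlarges the window, but at most by a factor of 5, so its size cannot jump over the range
    from [m] to [5 * m]. *)
Lemma reached_size m : (0 < m)%N -> exists Wn, reached Wn /\ (m <= #|` Wn| <= 5 * m)%N.
Proof.
elim: m => // -[_ _|m IH _].
  by exists [fset 0%N]%fset; rewrite cardfs1; split=> //; apply: reached0.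
have [//|Wn [Wr /andP[mW Wm]]] := IH.
case: (ltnP m.+1 #|` Wn|) => [lt|ge].
  by exists Wn; split=> //; lia.
have [Wn' [WW' W'e Wr']] := reached_step Wr.
exists Wn'; split=> //; have := fproper_ltn_card WW'; have := fsubset_leq_card W'e.
have := card_add_kids Wn; lia.
Qed.

Lemma DMVol_Omega_mender : exists (c : R) (N : nat), 0 < c /\
  forall n, (N <= n)%N -> exists G, [/\ gc G, gsize G = n & c * n%:R <= DMVol M G].
Proof.
(* With [m = n %/ 125], a window of at most [5 * m] vertices and its two layers have at most
   [125 * m <= n] vertices, and [m >= n / 250] once [n >= 125]. *)
exists (250%:R^-1), 125%N; split=> [|n n125]; first by rewrite invr_gt0 ltr0n.
pose m := (n %/ 125)%N; have m0 : (0 < m)%N by rewrite divn_gt0.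
have [Wn [Wr /andP[mW Wm]]] := reached_size m0; have [Wc Wcon] := Wr.
have Ec : tclosed (add_kids (add_kids Wn)) by do 2!apply: tclosed_add_kids.
have En : (#|` add_kids (add_kids Wn)| <= n)%N.
  have := card_add_kids (add_kids Wn); have := card_add_kids Wn; rewrite /m in Wm; lia.
have [S [Sc eS cS]] := tclosed_pad (n - #|` add_kids (add_kids Wn)|) Ec.
rewrite subnKC // in cS.
exists (tgraph S); split=> //; first exact: tgraph_gc.
pose v : vertex (tgraph S) := [` Sc.1]%fset; have v0 : fsval v = 0%N by [].
have vW : v \in window S Wn by rewrite inE v0; case: Wc.
apply: le_trans (DMVol_ge Mm (tgraph_gc Sc) (tgraph_hole Sc v0) (Wcon S Sc eS v v0) vW).
rewrite -card_names (names_window eS) mulrC ler_pdivrMr ?ltr0n // -natrM ler_nat.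
rewrite /m in mW m0; lia.
Qed.

End Omega.

Lemma DMVol_Omega (R : realType) (gc : graph -> Prop)
    (gcD : exists D, forall G, gc G -> degree_le D G) :
  (forall G, tree G -> degree_le 5 G -> gc G) ->
  has_Omega (sinkless gcD) (@DMVol R) (fun n => n%:R).
Proof. by move=> gct M Mm; exact: (DMVol_Omega_mender gct Mm). Qed.

(** The upper bounds need degree at most 5, the lower bound needs all trees of that degree; both
    graph classes of the theorem qualify. *)
Lemma sinkless_separates (R : realType) (gc : graph -> Prop)
    (gc5 : forall G, gc G -> degree_le 5 G) :
  (forall G, tree G -> degree_le 5 G -> gc G) ->
  let P := sinkless (gc_bounded gc5) in
  [/\ mends_exist P, has_o P (@EMVol R) (fun n => n%:R)
    & has_Theta P (@DMVol R) (fun n => n%:R)].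
Proof.
move=> gct P; split; [exact: sinkless_mends|exact: EMVol_o|].
by split; [exact: DMVol_O|exact: DMVol_Omega].
Qed.

Theorem mainTheorem7 (R : realType) :
  (exists (D : nat) (P : lcl),
      [/\ forall G, gclass P G <-> tree G /\ degree_le D G,
          mends_exist P,
          has_o P (@EMVol R) (fun n => n%:R)
        & has_Theta P (@DMVol R) (fun n => n%:R)])
  /\
  (exists (D : nat) (P : lcl),
      [/\ forall G, gclass P G <-> degree_le D G,
          mends_exist P,
          has_o P (@EMVol R) (fun n => n%:R)
        & has_Theta P (@DMVol R) (fun n => n%:R)]).
Proof.
split.
  pose gc5 G (H : tree G /\ degree_le 5 G) := H.2.
  have [] := @sinkless_separates R _ gc5 (fun G => @conj _ _).
  by exists 5%N, (sinkless (gc_bounded gc5)).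
have [] := @sinkless_separates R _ (fun G H => H) (fun G _ H => H).
by exists 5%N, (sinkless (gc_bounded (fun G (H : degree_le 5 G) => H))).
Qed.
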